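(* Let $q$ be an odd prime power and let $g=\gcd(q-1,3)$. Let $M\le \mathrm{SL}_3(\mathbb{F}_q)$ be the subgroup of all matrices $$\begin{pmatrix} a & b & x\\ c & d & y\\ 0&0&(\det\gamma)^{-1}\end{pmatrix},\qquad \gamma=\begin{pmatrix} a&b\\ c&d\end{pmatrix}\in \mathrm{GL}_2(\mathbb{F}_q),\ x,y\in\mathbb{F}_q .$$ (1) If $g=1$, then $M$ gives the minimal faithful permutation representation of $\mathrm{SL}_3(\mathbb{F}_q)$, and $$p(\mathrm{SL}_3(\mathbb{F}_q))=\frac{|\mathrm{SL}_3(\mathbb{F}_q)|}{|M|}=\frac{q^3-1}{q-1}.$$ (2) If $g=3$, let $G_3$ be the subgroup of $M$ of largest order among the subgroups of $M$ which have trivial intersection with the subgroup of order $3$ of the center of $\mathrm{SL}_3(\mathbb{F}_q)$ and whose order is not coprime to $3$. Then $G_3$ gives the minimal faithful permutation representation of $\mathrm{SL}_3(\mathbb{F}_q)$, and $$p(\mathrm{SL}_3(\mathbb{F}_q))=\frac{|\mathrm{SL}_3(\mathbb{F}_q)|}{|G_3|}=\frac{(q^3-1)\,(q-1)_3}{q-1}.$$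
   Context: For a finite group $G$, $p(G)$ is the smallest natural number $m$ such that the symmetric group $S_m$ has a subgroup isomorphic to $G$. Equivalently, $p(G)$ is the minimum of $\sum_i [G:H_i]$ over all finite collections $\{H_1,\dots,H_\ell\}$ of subgroups of $G$ with $\mathrm{core}_G(H_1\cap\dots\cap H_\ell)=\{e\}$, where $\mathrm{core}_G(H)=\bigcap_{x\in G}xHx^{-1}$. A subgroup $H$ of $G$ gives the minimal faithful permutation representation of $G$ if $\mathrm{core}_G(H)=\{e\}$ and $[G:H]=p(G)$. $(q-1)_3$ denotes the highest power of $3$ dividing $q-1$. The group $M$ is denoted $E_q^2:\mathrm{GL}_2(\mathbb{F}_q)$ (a subgroup of Aschbacher class $\mathscr{C}_1$) in the source. *)

(* Defs.v *)
From mathcomp Require Import all_boot all_order all_algebra all_fingroup all_solvable.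
Set Implicit Arguments.
Unset Strict Implicit.
Unset Printing Implicit Defensive.
Import GRing.Theory.
Local Open Scope group_scope.

Section MinimalPermutationDegree.

Variable gT : finGroupType.
Implicit Types G H : {group gT}.

Definition embeds_in_Sym G (m : nat) : bool :=
  [exists H : {group 'S_m}, G \isog H].

Definition regular_ord_act (i : 'I_#|gT|) (x : gT) : 'I_#|gT| :=
  enum_rank (enum_val i * x).

Lemma regular_ord_act1 : regular_ord_act^~ 1 =1 id.
Proof. by move=> i; rewrite /regular_ord_act mulg1 enum_valK. Qed.

Lemma regular_ord_actM i : act_morph regular_ord_act i.
Proof. by move=> x y; rewrite /regular_ord_act enum_rankK mulgA. Qed.

Definition regular_ord_action := TotalAction regular_ord_act1 regular_ord_actM.

Lemma ex_embeds_in_Sym G : exists m, embeds_in_Sym G m.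
Proof.
exists #|gT|; apply/existsP.
exists (actperm regular_ord_action @* G)%G.
apply: sub_isog; first exact: subsetT.
apply/injmP=> x y _ _ /permP/(_ (enum_rank 1)).
rewrite !actpermE /= /regular_ord_act !enum_rankK !mul1g.
exact: enum_rank_inj.
Qed.

(* p(G) *)
Definition min_perm_degree G : nat := ex_minn (ex_embeds_in_Sym G).

Definition gives_min_faithful_perm_rep G H : Prop :=
  [/\ H \subset G, gcore H G = 1 & #|G : H| = min_perm_degree G].

End MinimalPermutationDegree.

Section SL3.

Variable F : finFieldType.

Definition SL3 : {set {'GL_3[F]}} :=
  [set u : {'GL_3[F]} | (\det (GLval u) == 1)%R].

Lemma SL3_group_set : group_set SL3.
Proof.
apply/group_setP; split=> [|u v]; first by rewrite inE GL_1E det1.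
by rewrite !inE GL_MxE det_mulmx => /eqP-> /eqP->; rewrite mulr1.
Qed.

Canonical SL3_group := Group SL3_group_set.

(* The group M, also denoted E_q^2 : GL_2(F_q). *)
Definition parabolic_mx (g : {'GL_2[F]}) (v : 'cV[F]_2) : 'M[F]_3 :=
  @block_mx _ 2 1 2 1 (GLval g) v
                       0%R       ((\det (GLval g))^-1)%R%:M.

Definition parabolic : {set {'GL_3[F]}} :=
  [set u : {'GL_3[F]} |
     [exists g : {'GL_2[F]}, exists v : 'cV[F]_2, GLval u == parabolic_mx g v]].

Lemma parabolic_group_set : group_set parabolic.
Proof.
apply/group_setP; split=> [|u1 u2].
  rewrite inE; apply/existsP; exists 1; apply/existsP; exists 0%R.
  by rewrite /parabolic_mx !GL_1E det1 invr1 -scalar_mx_block.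
rewrite !inE => /existsP[g1 /existsP[v1 /eqP E1]].
case/existsP=> g2 /existsP[v2 /eqP E2].
apply/existsP; exists (g1 * g2); apply/existsP.
exists (GLval g1 *m v2 + v1 *m ((\det (GLval g2))^-1)%R%:M)%R.
rewrite GL_MxE E1 E2 /parabolic_mx; apply/eqP.
apply: etrans (@mulmx_block _ 2 1 2 1 2 1 _ _ _ _ _ _ _ _) _.
rewrite GL_MxE.
rewrite !mul0mx !mulmx0 !addr0 add0r -scalar_mxM det_mulmx.
by rewrite invfM.
Qed.

Canonical parabolic_group := Group parabolic_group_set.

Lemma parabolic_sub_SL3 : parabolic \subset SL3.
Proof.
apply/subsetP=> u; rewrite !inE => /existsP[g /existsP[v /eqP->]].
rewrite /parabolic_mx (@det_ublock _ 2 1) det_scalar1 mulfV //.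
by have := GL_unitmx g; rewrite unitmxE unitfE.
Qed.

(* Z3 stands for the subgroup of order 3 of the center of SL_3(F). *)
Definition G3_candidate (Z3 K : {group {'GL_3[F]}}) : bool :=
  [&& K \subset parabolic, K :&: Z3 == 1 & ~~ coprime #|K| 3].

Definition is_G3 (Z3 K : {group {'GL_3[F]}}) : Prop :=
  G3_candidate Z3 K /\
  forall L : {group {'GL_3[F]}}, G3_candidate Z3 L -> #|L| <= #|K|.

End SL3.

(* Main.v *)
(* Write G for SL_3(q), P for the parabolic subgroup, and d for the 3-part of q - 1, so that
   |G : P| = q^2 + q + 1 and d <= (q - 1)/2.  The degree of a faithful action is at least |G : H| for
   the stabilizer H of a point moved by a central element of order 3 (or by any element when g = 1);
   such an H contains no nontrivial scalar, and everything reduces to |G : H| >= d |G : P| when H <> G.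

   If H fixes a point or a line of the projective plane, then H lies in a conjugate of P or of its
   transpose.  Comparing H with the normal subgroup of P of matrices (a I, v; 0, a^-2), a of 3-power
   order, which H meets in elations only, gives d |H| <= |P|.  Equality holds for the matrices of P
   whose last entry has order prime to 3.

   Otherwise suppose |G : H| < d |G : P|; then 2 |G : H| < (q^3 - 1) and H contains a full root
   subgroup {1 + t u a}.  For a line l let E_l be the group of q^2 elations with axis l, and H_l the
   stabilizer of l in H, whose order exceeds 2 (q - 1)(q^2 - 1).
   - If 1 < |H :&: E_l| <= q for some l, the centralizer in H_l of an elation, or the action of H_l
     on H :&: E_l, yields a subgroup of the affine group of F of order at least q.  Such a group
     contains all translations, which produces the root subgroup.
   - If H :&: E_l = 1 for some l, the same argument shows that H_l induces SL_2(q) on l.  Hence H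
     has an element inducing -1 on l, which centralizes H_l; the preimages of transvections then form
     a root subgroup.
   - If |H :&: E_l| > q for every l, then H has elations for every flag.  Counting modulo p shows
     that all the root subgroups inside E_l meet H in the same number r of elements, so
     |H :&: E_l| - 1 = (q + 1)(r - 1), and since these are powers of p, r = q.
   Commutators of the conjugates of this root subgroup generate G, as H is irreducible. *)
Require Import Defs.
From mathcomp Require Import all_boot all_order all_algebra all_fingroup all_solvable all_field.
From mathcomp Require Import ring zify.
Set Implicit Arguments.
Unset Strict Implicit.
Unset Printing Implicit Defensive.
Import GRing.Theory FinRing.Theory.

(** * Explicit 3x3 matrices and the groups involved *)

Local Notation o0 := (@Ordinal 3 0 isT).
Local Notation o1 := (@Ordinal 3 1 isT).
Local Notation o2 := (@Ordinal 3 2 isT).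

Section Preliminaries.
Local Open Scope ring_scope.

Lemma ord3_ind (P : 'I_3 -> Prop) : P o0 -> P o1 -> P o2 -> forall i, P i.
Proof.
by move=> P0 P1 P2 [[|[|[|i]]] lti] //; rewrite (bool_irrelevance lti isT).
Qed.

Lemma big_ord3 (V : zmodType) (f : 'I_3 -> V) :
  \sum_(i < 3) f i = f o0 + f o1 + f o2.
Proof.
rewrite !big_ord_recl big_ord0 Monoid.mulm1 Monoid.mulmA /=.
by congr (f _ + f _ + f _); apply: val_inj.
Qed.

(** A group of affine maps of the field, with translations [B] and multipliers [C], has order less
    than q unless [B] is everything. It is used contrapositively: a count of at least q forces every
    translation to occur. *)
Lemma AGL_bound (F : finFieldType) (B C : {set F}) (f : F) :
  {in B &, forall x y, x - y \in B} ->
  (forall c, c \in C -> c != 0) ->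
  {in C &, forall c d, c / d \in C} ->
  {in C & B, forall c b, c * b \in B} ->
  f \notin B -> (#|B| * #|C| < #|F|)%N.
Proof.
move=> subB C0 divC CB fB.
have [->|[b0 b0B]] := set_0Vmem B.
  by rewrite cards0 mul0n; apply/card_gt0P; exists f.
have zB : 0 \in B by rewrite -(subrr b0) subB.
have [->|[c0 c0C]] := set_0Vmem C.
  by rewrite cards0 muln0; apply/card_gt0P; exists f.
have oC : 1 \in C by rewrite -(divff (C0 _ c0C)) divC.
have stab c y : c \in C -> c != 1 -> (c - 1) * y \in B -> y \in B.
  move=> cC c1 cy.
  have E : [set (c - 1) * b | b in B] = B.
    apply/eqP; rewrite eqEcard; apply/andP; split.
      apply/subsetP=> _ /imsetP[b bB ->].
      by rewrite mulrBl mul1r subB // CB.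
    by rewrite card_imset //; apply: mulfI; rewrite subr_eq0.
  move: cy; rewrite -{1}E => /imsetP[b bB /mulfI->] //.
  by rewrite subr_eq0.
(* [c - 1] permutes [B], so [(b, c) |-> b + c f] is injective and avoids [B]. *)
pose h (bc : F * F) := bc.1 + bc.2 * f.
have fNB b c : b \in B -> c \in C -> h (b, c) \notin B.
  move=> bB cC; apply: contra fB => hB.
  have : c * f \in B by rewrite -[c * f](addKr b) addrC -/(h (b,c)) subB.
  move=> cfB; have := CB (1 / c) _ (divC _ _ oC cC) cfB.
  by rewrite mulrA divfK ?C0 // mul1r.
have injh : {in setX B C &, injective h}.
  move=> [b c] [b' c'] /setXP[/= bB cC] /setXP[/= bB' cC'] E.
  have Ec : c = c'.
    apply/eqP; apply: contraNT fB => cc'.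
    apply: (stab (c / c')); first exact: divC.
      by apply: contra cc' => /eqP Ecc; rewrite -(divfK (C0 _ cC') c) Ecc mul1r.
    have -> : (c / c' - 1) * f = (1 / c') * (c * f - c' * f).
      by field; exact: C0.
    apply: CB; first exact: divC.
    have -> : c * f - c' * f = b' - b; last exact: subB.
    by move: E; rewrite /h /= => E; apply/eqP; rewrite subr_eq addrAC -E addrAC subrr add0r.
  by move: E; rewrite /h /= Ec => /addIr->.
rewrite -cardsX -(card_in_imset injh) -cardsT; apply: proper_card.
apply/properP; split; first exact: subsetT.
exists 0; rewrite ?inE //; apply/imsetP=> -[[b c] /setXP[/= bB cC] E].
by move: (fNB _ _ bB cC); rewrite -E zB.
Qed.

(** Left translation by the inverse of one of its elements carries each fibre of [f] into [K1]. Here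
    [f] is any function, so matrix entries can play the part of homomorphisms. *)
Lemma card_le_fibers (gT : finGroupType) (T : finType) (K : {set gT}) (K1 : {set gT})
    (S : {set T}) (f : gT -> T) :
  {in K, forall x, f x \in S} ->
  {in K &, forall x y, f x = f y -> (x^-1 * y)%g \in K1} ->
  (#|K| <= #|K1| * #|S|)%N.
Proof.
move=> fS fK.
rewrite -sum1_card (partition_big f [in S]) //=.
rewrite mulnC -sum_nat_const; apply: leq_sum => t tS.
have [K0|[x]] := set_0Vmem [set x in K | f x == t].
  rewrite big_pred0 // => x; apply/negP=> Kx.
  by have := in_set0 x; rewrite -K0 inE Kx.
rewrite inE => /andP[xK /eqP ft].
rewrite sum1dep_card -(card_imset _ (mulgI x^-1)%g).
apply/subset_leq_card/subsetP=> _ /imsetP[y + ->].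
by rewrite inE => /andP[yK /eqP ft']; apply: fK => //; rewrite ft ft'.
Qed.

Lemma card_add_closed (V : finZmodType) (A : {set V}) :
  0 \in A -> {in A &, forall x y, x + y \in A} -> (#|A| %| #|V|)%N.
Proof.
move=> A0 AD; have gA : group_set A by apply/group_setP.
by have := cardSg (subsetT (Group gA)); rewrite cardsT.
Qed.

End Preliminaries.

Definition GL3 (F : finFieldType) : finGroupType := {'GL_3[F]}.

Definition mx3 (F : finFieldType) : GL3 F -> 'M[F]_3 := @GLval 3 F.

Section Matrices3.
Local Open Scope ring_scope.
Variable F : finFieldType.
Implicit Types (A B : 'M[F]_3).

Lemma mulmx3E A B i j :
  (A *m B) i j = A i o0 * B o0 j + A i o1 * B o1 j + A i o2 * B o2 j.
Proof. by rewrite mxE big_ord3. Qed.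

Lemma det3E A : \det A =
  A o0 o0 * (A o1 o1 * A o2 o2 - A o1 o2 * A o2 o1)
  - A o0 o1 * (A o1 o0 * A o2 o2 - A o1 o2 * A o2 o0)
  + A o0 o2 * (A o1 o0 * A o2 o1 - A o1 o1 * A o2 o0).
Proof.
rewrite (expand_det_row _ o0) big_ord3 /cofactor.
do 3 rewrite (expand_det_row _ ord0) 2!big_ord_recl big_ord0 /cofactor !det_mx11 !mxE /=.
(* Cofactor expansion leaves indices built from nested lifts. Rewriting them through [inord] lets
   computation reduce them to numerals that [ring] can match. *)
pose a k l := A (inord k) (inord l).
have E k l : A k l = a k l by rewrite /a !inord_val.
by rewrite !E /=; ring.
Qed.

Definition m33 a b c d e f g h i : 'M[F]_3 :=
  \matrix_(k, l) nth 0 (nth [::] [:: [:: a; b; c]; [:: d; e; f]; [:: g; h; i]] k) l.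

(** A singular matrix is sent to the identity, hence the determinant condition in [toGLE]. *)
Definition toGL A : GL3 F := insubd (1%g : {'GL_3[F]}) A.

Lemma toGLE A : \det A != 0 -> mx3 (toGL A) = A.
Proof.
move=> dA; have uA : A \in unitmx by rewrite unitmxE unitfE.
exact: (insubdK (1%g : {'GL_3[F]}) uA).
Qed.

Lemma m33_det a b c d e f g h i :
  \det (m33 a b c d e f g h i) =
  a * (e * i - f * h) - b * (d * i - f * g) + c * (d * h - e * g).
Proof. by rewrite det3E !mxE. Qed.

Lemma toGL_m33 a b c d e f g h i :
  a * (e * i - f * h) - b * (d * i - f * g) + c * (d * h - e * g) != 0 ->
  mx3 (toGL (m33 a b c d e f g h i)) = m33 a b c d e f g h i.
Proof. by move=> D; rewrite toGLE ?m33_det. Qed.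

Lemma mx3_inj : injective (@mx3 F).
Proof. exact: val_inj. Qed.

Lemma mx3M (x y : GL3 F) : mx3 (x * y)%g = mx3 x *m mx3 y.
Proof. exact: (@GL_MxE 3 F x y). Qed.

Lemma mx3ME (x y : GL3 F) i j : mx3 (x * y)%g i j =
  mx3 x i o0 * mx3 y o0 j + mx3 x i o1 * mx3 y o1 j + mx3 x i o2 * mx3 y o2 j.
Proof. by rewrite mx3M mulmx3E. Qed.

Lemma mx3_1 : mx3 (1%g : GL3 F) = 1%:M.
Proof. exact: (@GL_1E 3 F). Qed.

Lemma mx3_1E i j : mx3 (1%g : GL3 F) i j = (i == j)%:R.
Proof. by rewrite mx3_1 mxE. Qed.

Lemma mx3_eq (x y : GL3 F) : (forall i j, mx3 x i j = mx3 y i j) -> x = y.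
Proof. by move=> E; apply: mx3_inj; apply/matrixP. Qed.

Lemma det_mx3 (x : GL3 F) : \det (mx3 x) != 0.
Proof. by have := GL_unitmx x; rewrite unitmxE unitfE. Qed.

Definition SL : {group GL3 F} := SL3_group F.
Definition PB : {group GL3 F} := parabolic_group F.

Lemma SL3P (x : GL3 F) : reflect (\det (mx3 x) = 1) (x \in SL).
Proof. by rewrite inE; apply: eqP. Qed.

Lemma PB_sub_SL : PB \subset SL.
Proof. exact: (parabolic_sub_SL3 F). Qed.

(** Two vanishing entries replace the block form; determinant 1 then forces the corner to be the
    inverse of the determinant of the 2x2 block. *)
Lemma parabolicP (x : GL3 F) :
  reflect [/\ x \in SL, mx3 x o2 o0 = 0 & mx3 x o2 o1 = 0] (x \in PB).
Proof.
apply: (iffP idP) => [xP|[xS x20 x21]].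
  have low (a : 'M[F]_2) (v : 'cV_2) (d : 'M_1) (i : 'I_1) (j : 'I_2) :
      (block_mx a v 0 d : 'M_(2 + 1)) (rshift 2 i) (lshift 1 j) = 0.
    by rewrite block_mxEdl mxE.
  split; first exact: (subsetP (parabolic_sub_SL3 F)).
    move: xP; rewrite inE /mx3 => /existsP[g /existsP[v /eqP->]].
    rewrite -(low (GLval g) v (\det (GLval g))^-1%:M ord0 ord0).
    by congr (parabolic_mx _ _ _ _); apply: val_inj.
  move: xP; rewrite inE /mx3 => /existsP[g /existsP[v /eqP->]].
  rewrite -(low (GLval g) v (\det (GLval g))^-1%:M ord0 ord_max).
  by congr (parabolic_mx _ _ _ _); apply: val_inj.
have dx := SL3P _ xS; rewrite inE.
pose X : 'M[F]_(2 + 1) := mx3 x.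
have Xe : X = block_mx (ulsubmx X) (ursubmx X) 0 (drsubmx X).
  rewrite -{1}[X]submxK; congr block_mx.
  apply/matrixP=> i j; rewrite !mxE.
  rewrite ord1; case: j => -[|[|//]] lj.
    by rewrite -[RHS]x20; congr (mx3 x _ _); apply: val_inj.
  by rewrite -[RHS]x21; congr (mx3 x _ _); apply: val_inj.
have dX : \det (ulsubmx X) * (drsubmx X) ord0 ord0 = 1.
  by rewrite -det_mx11 -(@det_ublock _ 2 1 _ (ursubmx X)) -Xe.
have d0 : \det (ulsubmx X) != 0.
  by apply: contra_eq_neq dX => ->; rewrite mul0r eq_sym oner_eq0.
have uX : (ulsubmx X : 'M_2) \in unitmx by rewrite unitmxE unitfE.
apply/existsP; exists (insubd (1%g : {'GL_2[F]}) (ulsubmx X)).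
apply/existsP; exists (ursubmx X); rewrite /parabolic_mx.
have -> : GLval (insubd (1%g : {'GL_2[F]}) (ulsubmx X)) = ulsubmx X by apply: insubdK.
apply/eqP; apply: (etrans Xe).
suff -> : drsubmx X = (\det (ulsubmx X))^-1%:M by [].
apply/matrixP=> i j; rewrite !ord1 [RHS]mxE eqxx mulr1n.
by apply: (mulfI d0); rewrite dX divff.
Qed.

End Matrices3.

Arguments SL : clear implicits.
Arguments PB : clear implicits.

(** * Orders of the parabolic subgroup and of SL_3 *)

Section Cards.
Local Open Scope ring_scope.
Variable F : finFieldType.
Local Notation q := #|F|.

Lemma card_nz : #|[set c : F | c != 0]| = (q - 1)%N.
Proof.
have := cardsC1 (0 : F); rewrite subn1 => <-.
by apply: eq_card => c; rewrite !inE.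
Qed.

Lemma card_PB : #|PB F| = (q ^ 3 * (q - 1) * (q ^ 2 - 1))%N.
Proof.
pose f (gv : {'GL_2[F]} * 'cV[F]_2) := toGL (parabolic_mx gv.1 gv.2).
have dg (g : {'GL_2[F]}) : \det (GLval g) != 0.
  by have := GL_unitmx g; rewrite unitmxE unitfE.
have fE gv : mx3 (f gv) = parabolic_mx gv.1 gv.2.
  by apply: toGLE; rewrite (@det_ublock _ 2 1) det_scalar1 mulfV ?oner_eq0.
have injf : injective f.
  move=> [g v] [g' v'] /(congr1 (@mx3 F)); rewrite !fE /= => E.
  have [Eg Ev _ _] := @eq_block_mx _ 2 1 2 1 _ _ _ _ _ _ _ _ E.
  by rewrite Ev; congr (_, _); apply: val_inj.
have -> : #|parabolic F| = #|codom f|.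
  apply: eq_card => x; rewrite inE; apply/existsP/codomP.
    by case=> g /existsP[v /eqP E]; exists (g, v); apply: mx3_inj; apply: (etrans E (esym (fE (g, v)))).
  by case=> -[g v] ->; exists g; apply/existsP; exists v; apply/eqP; exact: (fE (g, v)).
rewrite card_codom // card_prod -cardsT card_GL_2 card_mx.
have : (1 < q)%N by apply: card_finNzRing_gt1.
by case: (q) => [|[|n]] // _; rewrite subn1 /=; nia.
Qed.

(** Every element of GL_3 is uniquely diag(c, 1, 1) times an element of SL_3, where c is its
    determinant. *)
Lemma card_SL_GL3 : (#|SL F| * (q - 1) = #|GL3 F|)%N.
Proof.
pose d (c : F) := toGL (m33 c 0 0 0 1 0 0 0 1).
have dE c : c != 0 -> \det (mx3 (d c)) = c.
  move=> c0; have D : \det (m33 c 0 0 0 1 0 0 0 1) = c by rewrite m33_det; ring.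
  by rewrite toGLE D.
pose f (xc : GL3 F * F) := (d xc.2 * xc.1)%g.
have injf : {in setX (SL F) [set c | c != 0] &, injective f}.
  move=> [x c] [x' c'] /setXP[/= /SL3P dx]; rewrite inE => c0.
  move=> /setXP[/= /SL3P dx']; rewrite inE => c0' E.
  have Ec : c = c'.
    have : \det (mx3 (d c * x)%g) = \det (mx3 (d c' * x')%g).
      by rewrite -[(d c * x)%g]/(f (x, c)) E.
    by rewrite !mx3M !det_mulmx !dE // dx dx' !mulr1.
  by move: E; rewrite /f Ec => /mulgI /= ->.
have surj g : g \in f @: setX (SL F) [set c | c != 0].
  have dg := det_mx3 g; apply/imsetP.
  exists ((d (\det (mx3 g)))^-1 * g, \det (mx3 g))%g; last by rewrite /f /= mulKVg.
  apply/setXP; split; last by rewrite inE.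
  apply/SL3P; apply: (mulfI dg).
  by rewrite mulr1 -{1}(dE _ dg) -det_mulmx -mx3M mulKVg.
rewrite -card_nz -cardsX -(card_in_imset injf); apply: eq_card => g.
by rewrite [in RHS]inE; apply: surj.
Qed.

Lemma card_SL : #|SL F| = (#|PB F| * (q ^ 2 + q + 1))%N.
Proof.
apply/eqP; rewrite -(eqn_pmul2r (_ : 0 < q - 1)%N) ?subn_gt0 ?card_finNzRing_gt1 //.
rewrite card_SL_GL3 -cardsT card_GL // card_PB.
rewrite big_ltn // big_ltn // big_ltn // big_geq // (_ : 'C(3, 2) = 3) //.
have : (1 < q)%N by apply: card_finNzRing_gt1.
case: (q) => [|[|n]] // _; apply/eqP.
rewrite !expnS expn0 !muln1 !subn1 /=; nia.
Qed.
End Cards.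

(* Otherwise unification unfolds the group operations of ['GL_3[F]]. *)
Opaque GL3 mx3 SL PB.

(** * Elations and the parabolic subgroup *)

Section ScalarFree.
Local Open Scope ring_scope.
Variable F : finFieldType.
Local Notation q := #|F|.
Local Notation gT := (GL3 F).
Implicit Types (x y z g : gT) (H : {group gT}).

Definition scalar_free (H : {set gT}) :=
  forall (x : gT) (c : F), x \in H -> mx3 x = c%:M -> c = 1.

Lemma card_natr0 : q%:R = 0 :> F.
Proof. by have := expg_cardG (in_setT (1 : F)); rewrite zmodXgE cardsT. Qed.

Lemma two_neq0 : odd q -> 2%:R != 0 :> F.
Proof.
move=> oddq; apply: contraTneq (oner_neq0 F) => two0; rewrite negbK.
by have := card_natr0; rewrite -(odd_double_half q) oddq -muln2 natrD natrM two0 mulr0 addr0 => /eqP.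
Qed.

(** Write x = c + N with N strictly upper triangular. As N^3 = 0 and p >= 3, x^p is the scalar c^p,
    which must be 1; the Frobenius map is injective, so c = 1. *)
Lemma unipotent_scalar H x c : odd q -> scalar_free H -> x \in H ->
  mx3 x o0 o0 = c -> mx3 x o1 o1 = c -> mx3 x o2 o2 = c ->
  mx3 x o1 o0 = 0 -> mx3 x o2 o0 = 0 -> mx3 x o2 o1 = 0 -> c = 1.
Proof.
move=> oddq sfH xH x00 x11 x22 x10 x20 x21.
have [p pr_p chp] := finPcharP F.
have chpM : p \in [pchar 'M[F]_3] by rewrite pchar_lalg.
have p3 : (2 < p)%N.
  rewrite ltn_neqAle prime_gt1 // andbT; apply: contraTneq chp => <-.
  by rewrite inE (negPf (two_neq0 oddq)) andbF.
pose N : 'M[F]_3 := mx3 x - c%:M.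
have N3 : N ^+ 3 = 0.
  apply/matrixP=> i j; rewrite !exprS expr0 mulr1 !mulmx3E.
  move: i j; do 2 apply: ord3_ind; rewrite !mxE /= ?mulr1n ?mulr0n ?x00 ?x11 ?x22 ?x10 ?x20 ?x21; ring.
have xp n : mx3 (x ^+ n)%g = (mx3 x : 'M_3) ^+ n.
  by elim: n => [|n IHn]; rewrite ?expg0 ?expr0 // expgS exprS mx3M IHn.
have E : mx3 (x ^+ p)%g = (c ^+ p)%:M.
  rewrite xp -[mx3 x](subrK c%:M) -/N.
  rewrite -!(pFrobenius_autE chpM) pFrobenius_autD_comm; last exact: scalar_mxC.
  by rewrite !pFrobenius_autE -(subnK p3) exprD N3 mulr0 add0r rmorphXn.
have cp := sfH _ _ (groupX p xH) E.
by apply: (fmorph_inj (pFrobenius_aut chp)); rewrite rmorph1.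
Qed.

End ScalarFree.

Section Elations.
Local Open Scope ring_scope.
Variable F : finFieldType.
Local Notation q := #|F|.
Local Notation gT := (GL3 F).
Implicit Types (x y z g : gT) (H : {group gT}).

Lemma parabolic_det x : x \in PB F ->
  (mx3 x o0 o0 * mx3 x o1 o1 - mx3 x o0 o1 * mx3 x o1 o0) * mx3 x o2 o2 = 1.
Proof.
by case/parabolicP=> /SL3P; rewrite det3E => <- -> ->; ring.
Qed.

(** The unipotent radical of [PB]: in the action on columns, the elations whose axis is the line
    where the last coordinate vanishes. The entries (0, 2) and (1, 2) give the centre. *)
Definition elations : {set gT} :=
  [set x : gT | [&& mx3 x o0 o0 == 1, mx3 x o1 o1 == 1, mx3 x o2 o2 == 1, mx3 x o0 o1 == 0,
                    mx3 x o1 o0 == 0, mx3 x o2 o0 == 0 & mx3 x o2 o1 == 0]].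

Lemma elationsP x : reflect
  ([/\ mx3 x o0 o0 = 1, mx3 x o1 o1 = 1 & mx3 x o2 o2 = 1] /\
   [/\ mx3 x o0 o1 = 0, mx3 x o1 o0 = 0, mx3 x o2 o0 = 0 & mx3 x o2 o1 = 0]) (x \in elations).
Proof.
rewrite inE; apply: (iffP and5P).
  by case=> /eqP-> /eqP-> /eqP-> /eqP-> /and3P[/eqP-> /eqP-> /eqP->].
by case=> -[-> -> ->] [-> -> -> ->]; rewrite !eqxx; split.
Qed.

Lemma elations_SL3 x : x \in elations -> x \in SL F.
Proof.
case/elationsP=> -[a b c] [d e f g]; apply/SL3P.
by rewrite det3E a b c d e f g; ring.
Qed.

Lemma elations_parabolic x : x \in elations -> x \in PB F.
Proof.
move=> Ex; apply/parabolicP; split; first exact: elations_SL3.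
all: by case/elationsP: Ex => _ [].
Qed.

Lemma elations_eq x y : x \in elations -> y \in elations ->
  mx3 x o0 o2 = mx3 y o0 o2 -> mx3 x o1 o2 = mx3 y o1 o2 -> x = y.
Proof.
case/elationsP=> -[a b c] [d e f g]; case/elationsP=> -[a' b' c'] [d' e' f' g'] h k.
by apply: mx3_eq; do 2 apply: ord3_ind; congruence.
Qed.

Lemma card_elations_le : (#|elations| <= q ^ 2)%N.
Proof.
pose f (x : gT) := (mx3 x o0 o2, mx3 x o1 o2).
have injf : {in elations &, injective f}.
  by move=> x y Ex Ey [E1 E2]; apply: elations_eq.
by rewrite -(card_in_imset injf) (leq_trans (max_card _)) // card_prod mulnn.
Qed.

(** The stabilizer of this axis in the whole of GL_3, so that elations can be normalized by
    conjugators of any determinant. *)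
Definition row_stab : {set gT} := [set x : gT | (mx3 x o2 o0 == 0) && (mx3 x o2 o1 == 0)].

Lemma row_stabP x : reflect (mx3 x o2 o0 = 0 /\ mx3 x o2 o1 = 0) (x \in row_stab).
Proof. by rewrite inE; apply: (iffP andP) => -[/eqP ? /eqP ?]. Qed.

Lemma row_stab_group_set : group_set row_stab.
Proof.
apply/group_setP; split; first by apply/row_stabP; rewrite !mx3_1E.
move=> x y /row_stabP[x20 x21] /row_stabP[y20 y21].
by apply/row_stabP; rewrite !mx3ME x20 x21 y20 y21; split; ring.
Qed.

Canonical row_stab_group := Group row_stab_group_set.

Lemma row_stabM x y : x \in row_stab -> y \in row_stab -> (x * y)%g \in row_stab.
Proof. by have [_ M] := group_setP row_stab_group_set; apply: M. Qed.

Lemma row_stabV x : x \in row_stab -> (x^-1)%g \in row_stab.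
Proof. exact: (@groupVr _ row_stab_group x). Qed.

Lemma parabolic_row_stab x : x \in PB F -> x \in row_stab.
Proof. by case/parabolicP=> _ x20 x21; apply/row_stabP. Qed.

Lemma row_stab_det x : x \in row_stab ->
  (mx3 x o0 o0 * mx3 x o1 o1 - mx3 x o0 o1 * mx3 x o1 o0) * mx3 x o2 o2 != 0.
Proof.
case/row_stabP=> x20 x21; have := det_mx3 x; rewrite det3E x20 x21.
by congr (_ != 0); ring.
Qed.

(** The elations are the kernel of the map from [row_stab] to its diagonal blocks; injectivity of
    the 2x2 block is Cramer's rule ([ker2]). *)
Lemma row_stab_same_block x y : x \in row_stab -> y \in row_stab ->
  mx3 x o0 o0 = mx3 y o0 o0 -> mx3 x o0 o1 = mx3 y o0 o1 ->
  mx3 x o1 o0 = mx3 y o1 o0 -> mx3 x o1 o1 = mx3 y o1 o1 -> mx3 x o2 o2 = mx3 y o2 o2 ->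
  (x^-1 * y)%g \in elations.
Proof.
move=> xP yP E00 E01 E10 E11 E22.
pose z0 : gT := (x^-1 * y)%g; rewrite -/z0.
have Ey : y = (x * z0)%g by rewrite mulKVg.
move: z0 Ey => z Ey.
have zP : z \in row_stab by rewrite -(mulKg x z) -Ey row_stabM ?row_stabV.
have [z20 z21] := row_stabP _ zP.
have := mx3ME x z; rewrite -Ey => yE.
have [x20 x21] := row_stabP _ xP.
have := row_stab_det xP; set dd := (_ * mx3 x o2 o2) => d0.
have ker2 a b : mx3 x o0 o0 * a + mx3 x o0 o1 * b = 0 -> mx3 x o1 o0 * a + mx3 x o1 o1 * b = 0 ->
    a = 0 /\ b = 0.
  move=> Ea Eb; split; apply: (mulfI d0); rewrite mulr0 /dd.
    rewrite (_ : _ * a = mx3 x o2 o2 * (mx3 x o1 o1 * (mx3 x o0 o0 * a + mx3 x o0 o1 * b)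
                          - mx3 x o0 o1 * (mx3 x o1 o0 * a + mx3 x o1 o1 * b))); last by ring.
    by rewrite Ea Eb; ring.
  rewrite (_ : _ * b = mx3 x o2 o2 * (mx3 x o0 o0 * (mx3 x o1 o0 * a + mx3 x o1 o1 * b)
                        - mx3 x o1 o0 * (mx3 x o0 o0 * a + mx3 x o0 o1 * b))); last by ring.
  by rewrite Ea Eb; ring.
have x22 : mx3 x o2 o2 != 0 by move: d0; rewrite mulf_eq0 negb_or => /andP[].
have := yE o0 o0; have := yE o0 o1; have := yE o1 o0; have := yE o1 o1.
have := yE o2 o2; rewrite -E00 -E01 -E10 -E11 -E22 x20 x21 z20 z21 => h1 h2 h3 h4 h5.
have [/eqP z00 z10] : mx3 z o0 o0 - 1 = 0 /\ mx3 z o1 o0 = 0.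
  apply: ker2; rewrite mulrBr mulr1.
    by rewrite [X in _ - X]h5; ring.
  by rewrite [X in _ - X]h3; ring.
have [z01 /eqP z11] : mx3 z o0 o1 = 0 /\ mx3 z o1 o1 - 1 = 0.
  apply: ker2; rewrite mulrBr mulr1.
    by rewrite [X in _ + (_ - X)]h4; ring.
  by rewrite [X in _ + (_ - X)]h2; ring.
have z22 : mx3 z o2 o2 = 1.
  by apply: (mulfI x22); rewrite mulr1 [RHS]h1; ring.
by apply/elationsP; do ?split=> //; apply/eqP; rewrite -subr_eq0.
Qed.

Lemma parabolic_same_block x y : x \in PB F -> y \in PB F ->
  mx3 x o0 o0 = mx3 y o0 o0 -> mx3 x o0 o1 = mx3 y o0 o1 ->
  mx3 x o1 o0 = mx3 y o1 o0 -> mx3 x o1 o1 = mx3 y o1 o1 -> (x^-1 * y)%g \in elations.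
Proof.
move=> xP yP E00 E01 E10 E11.
apply: row_stab_same_block => //; try exact: parabolic_row_stab.
have dx := parabolic_det xP; have dy := parabolic_det yP.
have D : mx3 x o0 o0 * mx3 x o1 o1 - mx3 x o0 o1 * mx3 x o1 o0 != 0.
  by apply: contra_eq_neq dx => ->; rewrite mul0r eq_sym oner_neq0.
by apply: (mulfI D); rewrite dx -dy E00 E01 E10 E11.
Qed.

Lemma elationsJ x g : g \in row_stab -> (x ^ g \in elations)%g = (x \in elations).
Proof.
have J y h : h \in row_stab -> y \in elations -> (y ^ h)%g \in elations.
  move=> hS yE; have yS := parabolic_row_stab (elations_parabolic yE).
  have yhS : (y * h)%g \in row_stab by apply: row_stabM.
  have [[y00 y11 y22] [y01 y10 y20 y21]] := elationsP _ yE.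
  have [h20 h21] := row_stabP _ hS.
  rewrite conjgE; apply: row_stab_same_block => //;
    by rewrite mx3ME ?y00 ?y11 ?y22 ?y01 ?y10 ?y20 ?y21 ?h20 ?h21; ring.
move=> gS; apply/idP/idP; last exact: J.
by move/(J _ _ (row_stabV gS)); rewrite conjgK.
Qed.

Definition root02 t : gT := toGL (m33 1 0 t 0 1 0 0 0 1).

Lemma root02E t : mx3 (root02 t) = m33 1 0 t 0 1 0 0 0 1.
Proof.
rewrite toGL_m33 // (_ : _ - _ + _ = 1) ?oner_neq0 //; ring.
Qed.

Lemma root02_elations t : root02 t \in elations.
Proof. by apply/elationsP; rewrite root02E !mxE. Qed.

Lemma cent_root02_1P x : reflect
  [/\ mx3 x o1 o0 = 0, mx3 x o2 o0 = 0, mx3 x o2 o1 = 0 & mx3 x o0 o0 = mx3 x o2 o2] (x \in 'C[root02 1])%g.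
Proof.
apply: (iffP cent1P) => [E|[x10 x20 x21 x00]].
  have E' i j := congr1 (fun z : gT => mx3 z i j) E.
  split.
  - by have := E' o1 o2; rewrite !mx3ME root02E !mxE /=; move/eqP; rewrite -subr_eq0 => /eqP <-; ring.
  - by have := E' o2 o2; rewrite !mx3ME root02E !mxE /=; move/eqP; rewrite -subr_eq0 => /eqP <-; ring.
  - by have := E' o0 o1; rewrite !mx3ME root02E !mxE /=; move/eqP; rewrite eq_sym -subr_eq0 => /eqP <-; ring.
  - have := E' o0 o2; rewrite !mx3ME root02E !mxE /=; move/eqP; rewrite -subr_eq0 => /eqP E0.
    by apply/eqP; rewrite -subr_eq0 -E0; apply/eqP; ring.
apply: mx3_eq; do 2 apply: ord3_ind; rewrite !mx3ME root02E !mxE /= ?x10 ?x20 ?x21 ?x00; ring.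
Qed.

Lemma cent_root02_1_parabolic x : x \in SL F -> x \in 'C[root02 1]%g -> x \in PB F.
Proof. by move=> xS /cent_root02_1P[_ x20 x21 _]; apply/parabolicP. Qed.

Lemma elations_mul x y : x \in elations -> y \in elations ->
  [/\ (x * y)%g \in elations, mx3 (x * y)%g o0 o2 = mx3 x o0 o2 + mx3 y o0 o2
    & mx3 (x * y)%g o1 o2 = mx3 x o1 o2 + mx3 y o1 o2].
Proof.
case/elationsP=> -[a b c] [d e f g]; case/elationsP=> -[a' b' c'] [d' e' f' g'].
split; last 2 first.
- by rewrite mx3ME a d c'; ring.
- by rewrite mx3ME b e c'; ring.
by apply/elationsP; rewrite !mx3ME a b c d e f g a' b' c' d' e' f' g'; do !split; ring.
Qed.

Lemma root02D s t : root02 (s + t) = (root02 s * root02 t)%g.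
Proof.
have [E E0 E1] := elations_mul (root02_elations s) (root02_elations t).
apply: elations_eq => //; first exact: root02_elations.
  by rewrite E0 !root02E !mxE.
by rewrite E1 !root02E !mxE /= addr0.
Qed.

Lemma root02_eq x : x \in elations -> mx3 x o1 o2 = 0 -> x = root02 (mx3 x o0 o2).
Proof.
move=> xE x12; apply: elations_eq => //; first exact: root02_elations.
  by rewrite root02E mxE.
by rewrite x12 root02E mxE.
Qed.

(** The conjugator has the centre of [x] as its first column, completed by (c, d) to a basis of the
    axis. *)
Lemma elations_conj_root02 (x : gT) : x \in elations -> x != 1%g ->
  exists2 g, g \in row_stab & (x ^ g = root02 1)%g.
Proof.
move=> xE x1; have [[x00 x11 x22] [x01 x10 x20 x21]] := elationsP _ xE.
have conj (c d : F) : let D := mx3 x o0 o2 * d - c * mx3 x o1 o2 in D != 0 ->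
    exists2 g, g \in row_stab & (x ^ g = root02 1)%g.
  move=> D D0; pose g := toGL (m33 (mx3 x o0 o2) c 0 (mx3 x o1 o2) d 0 0 0 1).
  have gE : mx3 g = m33 (mx3 x o0 o2) c 0 (mx3 x o1 o2) d 0 0 0 1.
    by rewrite toGL_m33 //; apply: contraNneq D0; rewrite /D => <-; apply/eqP; ring.
  exists g; first by apply/row_stabP; rewrite gE !mxE.
  apply: (mulgI g); rewrite -conjgC; apply: mx3_eq.
  do 2 apply: ord3_ind; rewrite !mx3ME gE root02E !mxE /= ?x00 ?x11 ?x22 ?x01 ?x10 ?x20 ?x21; ring.
have [x02|x02] := eqVneq (mx3 x o0 o2) 0; last first.
  by apply: (conj 0 1); rewrite mulr1 mul0r subr0.
apply: (conj 1 0); rewrite mulr0 mul1r sub0r oppr_eq0.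
apply: contra x1 => /eqP x12; apply/eqP; apply: mx3_eq.
by do 2 apply: ord3_ind; rewrite mx3_1E //=.
Qed.

Lemma card_conj_elations (A : {set gT}) g : g \in row_stab ->
  #|A :^ g :&: elations|%g = #|A :&: elations|.
Proof.
move=> gS; rewrite -[RHS](cardJg _ g); congr #|pred_of_set _|.
apply/setP=> x; rewrite in_setI !mem_conjg in_setI; congr (_ && _).
by rewrite elationsJ ?row_stabV.
Qed.

Lemma SL_J x g : (x ^ g \in SL F)%g = (x \in SL F).
Proof.
apply/SL3P/SL3P=> <-; rewrite conjgE !mx3M !det_mulmx mulrCA -det_mulmx -mx3M mulVg;
  by rewrite mx3_1 det1 mulr1.
Qed.

(** In terms of the index, 2 |G : H| < q^3 - 1. This follows from |G : H| < d (q^2 + q + 1) because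
    2 d <= q - 1. *)
Definition large_subgroup H :=
  [/\ scalar_free H, H \subset SL F & 2 * #|SL F| < (q ^ 3 - 1) * #|H|]%N.

Lemma scalar_freeJ H (g : gT) : scalar_free H -> scalar_free (H :^ g)%G.
Proof.
move=> sfH x c; rewrite mem_conjg => xH Ex; apply: (sfH _ _ xH).
have gx : (g * x = x * g)%g by apply: mx3_inj; rewrite !mx3M Ex scalar_mxC.
have -> : (x ^ g^-1 = g * x * g^-1)%g by rewrite conjgE invgK mulgA.
by rewrite gx mulgK.
Qed.

Lemma large_subgroupJ H (g : gT) : large_subgroup H -> large_subgroup (H :^ g)%G.
Proof.
case=> sfH sHS lt; split; [exact: scalar_freeJ| |by rewrite cardJg].
by apply/subsetP=> x; rewrite mem_conjg => /(subsetP sHS); rewrite SL_J.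
Qed.

(** Combine |H| |P| = |HP| |H ∩ P| <= |G| |H ∩ P| with the order of P. *)
Lemma large_parabolic H : odd q -> large_subgroup H ->
  (2 * ((q - 1) * (q ^ 2 - 1)) < #|H :&: PB F|)%N.
Proof.
move=> oddq [_ sHS lt]; have q1 : (1 < q)%N := card_finNzRing_gt1 F.
have P0 : (0 < #|PB F|)%N := cardG_gt0 (PB F).
have E := mul_cardG H (PB F).
have le : (#|H| * #|PB F| <= #|SL F| * #|H :&: PB F|)%N.
  rewrite E leq_mul2r; apply/orP; right; apply: subset_leq_card.
  exact: (mul_subG (G := SL F) sHS (PB_sub_SL F)).
have H0 : (0 < #|SL F|)%N := cardG_gt0 (SL F).
have lt2 : (2 * #|PB F| < (q ^ 3 - 1) * #|H :&: PB F|)%N.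
  move: lt le P0 H0; move: #|H| #|SL F| #|PB F| #|H :&: _| (q ^ 3 - 1)%N; nia.
move: lt2; rewrite card_PB.
have := ltn_expl 3 q1; move: #|H :&: _| => m _ lt2.
have q3 : (0 < q ^ 3 - 1)%N by rewrite subn_gt0 -(exp1n 3) ltn_exp2r.
rewrite -(ltn_pmul2l q3); apply: leq_ltn_trans lt2.
by rewrite mulnCA -[in leqRHS]mulnA leq_mul // leq_mul ?leq_subr.
Qed.

End Elations.

(** * Transvections in the centralizer of an elation *)

Section TransvectionCentralizer.
Local Open Scope ring_scope.
Variable F : finFieldType.
Local Notation q := #|F|.
Local Notation gT := (GL3 F).
Implicit Types (x y z g : gT) (H : {group gT}).

(** The centralizer consists of upper triangular matrices with diagonal (a, a^-2, a). Its
    multipliers a^3 form [C], and the entries (0, 1) of its elements with a = 1 form [B]. The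
    remaining kernel lies in the elations, so |B| |C| >= q, and [AGL_bound] makes [B] the whole
    field. *)
Lemma centralizer_transvections H : odd q -> scalar_free H -> H \subset SL F ->
  (q * #|H :&: elations F| <= #|'C_H[root02 (1 : F)]%g|)%N ->
  forall b, exists x, [/\ x \in 'C_H[root02 (1 : F)]%g, mx3 x o0 o0 = 1 & mx3 x o0 o1 = b].
Proof.
move=> oddq sfH sHS leK b.
pose K := ('C_H[root02 (1 : F)])%G.
have KP x : x \in K -> [/\ x \in H,
    [/\ mx3 x o1 o0 = 0, mx3 x o2 o0 = 0, mx3 x o2 o1 = 0 & mx3 x o0 o0 = mx3 x o2 o2],
    x \in PB F, mx3 x o0 o0 ^+ 2 * mx3 x o1 o1 = 1 & mx3 x o0 o0 != 0].
  case/setIP=> xH xC; have xS := subsetP sHS _ xH.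
  have xP := cent_root02_1_parabolic xS xC; have := parabolic_det xP.
  case/cent_root02_1P: xC => x10 x20 x21 x00; rewrite x10 -x00 => dx.
  have D : mx3 x o0 o0 ^+ 2 * mx3 x o1 o1 = 1 by rewrite -dx; ring.
  by split=> //; apply: contra_eq_neq D => ->; rewrite expr0n mul0r eq_sym oner_neq0.
pose K1 := [set x : gT in K | mx3 x o0 o0 == 1].
pose B := [set mx3 x o0 o1 | x in K1].
(* The multiplier is x_00 / x_11, which is a cube since x_11 = x_00^-2. *)
pose C := [set mx3 x o0 o0 ^+ 3 | x in K].
have K11 x : x \in K1 -> [/\ x \in K, mx3 x o0 o0 = 1 & mx3 x o1 o1 = 1].
  rewrite inE => /andP[xK /eqP x00]; split=> //.
  by have [_ _ _ + _] := KP _ xK; rewrite x00 expr1n mul1r.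
(* If a^3 = 1, then a^-2 = a: the diagonal is constant and [unipotent_scalar] applies. *)
have cube1 x : x \in K -> mx3 x o0 o0 ^+ 3 = 1 -> mx3 x o0 o0 = 1.
  move=> xK c1; have [xH [x10 x20 x21 x00] _ dx xn0] := KP _ xK.
  apply: (unipotent_scalar oddq sfH xH) => //.
  by apply: (mulfI (expf_neq0 2 xn0)); rewrite dx -exprSr.
have leKC : (#|K| <= #|K1| * #|C|)%N.
  apply: (@card_le_fibers _ _ _ _ _ (fun x : gT => mx3 x o0 o0 ^+ 3)).
    by move=> x xK; apply: imset_f.
  move=> x y xK yK E; move: (x^-1 * y)%g (esym (mulKVg x y)) => z Ey.
  have zK : z \in K by move: yK; rewrite Ey groupMl.
  have [_ [x10 x20 _ _] _ _ xn0] := KP _ xK; have [_ [z10 z20 _ _] _ _ _] := KP _ zK.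
  rewrite inE zK; apply/eqP/cube1 => //.
  apply: (mulfI (expf_neq0 3 xn0)); rewrite mulr1 [RHS]E Ey mx3ME z10 z20; ring.
have leK1 : (#|K1| <= #|H :&: elations F| * #|B|)%N.
  apply: (@card_le_fibers _ _ _ _ _ (fun x : gT => mx3 x o0 o1)).
    by move=> x xK; apply: imset_f.
  move=> x y /K11[xK x00 x11] /K11[yK y00 y11] E.
  have [xH [x10 _ _ _] xP _ _] := KP _ xK; have [yH [y10 _ _ _] yP _ _] := KP _ yK.
  rewrite inE groupM ?groupV //=.
  by apply: parabolic_same_block; rewrite ?x00 ?x11 ?x10.
have eH : (0 < #|H :&: elations F|)%N.
  apply/card_gt0P; exists 1%g; rewrite inE group1.
  by apply/elationsP; rewrite !mx3_1E.
suff : b \in B by case/imsetP=> x /K11[xK x00 _] ->; exists x.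
apply/negPn/negP=> bB.
have : (#|B| * #|C| < q)%N.
  apply: (AGL_bound _ _ _ _ bB).
  - move=> _ _ /imsetP[x /K11[xK x00 x11] ->] /imsetP[y /K11[yK y00 y11] ->].
    have [z Ex] : exists z, x = (z * y)%g by exists (x * y^-1)%g; rewrite mulgKV.
    have zK : z \in K by move: xK; rewrite Ex (groupMr z yK).
    have [_ [x10 x20 x21 _] _ _ _] := KP _ xK.
    have [_ [y10 y20 y21 _] _ _ _] := KP _ yK.
    have z00 : mx3 z o0 o0 = 1 by have := mx3ME z y o0 o0; rewrite -Ex x00 y00 y10 y20 => ->; ring.
    apply/imsetP; exists z; first by rewrite inE zK z00 eqxx.
    by rewrite [in LHS]Ex mx3ME z00 y11 y21; ring.
  - by move=> _ /imsetP[x xK ->]; have [_ _ _ _ n0] := KP _ xK; rewrite expf_neq0.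
  - move=> _ _ /imsetP[x xK ->] /imsetP[y yK ->].
    have [z Ex] : exists z, x = (z * y)%g by exists (x * y^-1)%g; rewrite mulgKV.
    have zK : z \in K by move: xK; rewrite Ex (groupMr z yK).
    have [_ [y10 y20 y21 _] _ _ y00] := KP _ yK.
    apply/imsetP; exists z => //; apply: (canLR (mulfK (expf_neq0 3 y00))).
    by rewrite [in LHS]Ex mx3ME y10 y20; ring.
  - move=> _ _ /imsetP[g gK ->] /imsetP[k /K11[kK k00 k11] ->].
    have [z Ez] : exists z, (z * g = g * k)%g by exists (g * k * g^-1)%g; rewrite mulgKV.
    have zK : z \in K by rewrite -(groupMr z gK) Ez groupM.
    have [_ [g10 g20 g21 _] _ dg gn0] := KP _ gK.
    have [_ [k10 k20 k21 _] _ _ _] := KP _ kK.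
    have [_ [z10 z20 z21 _] _ _ _] := KP _ zK.
    have := congr1 (fun u : gT => mx3 u o0 o0) Ez.
    have := congr1 (fun u : gT => mx3 u o0 o1) Ez.
    rewrite !mx3ME g10 g20 g21 k00 k11 k10 k20 k21 => E01 E00.
    have z00 : mx3 z o0 o0 = 1.
      by apply: (mulIf gn0); rewrite mul1r; move: E00; rewrite !mulr0 !addr0 mulr1.
    apply/imsetP; exists z; first by rewrite inE zK z00 eqxx.
    move: E01; rewrite z00 mul1r !mulr0 !addr0 mulr1 [in RHS]addrC => /addrI E01.
    rewrite exprSr -mulrA -E01.
    by rewrite mulrCA dg mulr1.
rewrite ltnNge => /negP[]; rewrite -(leq_pmul2l eH).
by rewrite mulnC (leq_trans leK) // mulnA (leq_trans leKC) // leq_mul2r leK1 orbT.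
Qed.
End TransvectionCentralizer.

(** * Full root subgroups in large subgroups *)

Section FewElations.
Local Open Scope ring_scope.
Variable F : finFieldType.
Local Notation q := #|F|.
Local Notation gT := (GL3 F).
Implicit Types (x y z g h : gT) (H : {group gT}).

Lemma root02_neq1 : root02 (1 : F) != 1%g.
Proof.
apply/eqP=> /(congr1 (fun x => mx3 x o0 o2)).
by rewrite root02E mx3_1E mxE /= => /eqP; rewrite oner_eq0.
Qed.

Lemma card_PB_centralizer H m : H \subset SL F ->
  (#|(root02 (1 : F) ^: (H :&: PB F))%g| <= m)%N ->
  (#|H :&: PB F| <= #|'C_H[root02 (1 : F)]%g| * m)%N.
Proof.
move=> sHS le; rewrite -(Lagrange (subsetIl (H :&: PB F)%G 'C[root02 (1 : F)]%G)%g) /=.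
rewrite index_cent1 leq_mul //; apply: subset_leq_card.
by apply: setSI; apply: subsetIl.
Qed.

Lemma class_root02_sub H x : x \in H -> x \in elations F -> x != 1%g ->
  (x ^: (H :&: PB F))%g \subset (H :&: elations F) :\ 1%g.
Proof.
move=> xH xE x1; apply/subsetP=> _ /imsetP[h /setIP[hH hP] ->].
rewrite !inE conjg_eq1 x1 groupJ //=.
by have := elationsJ x (parabolic_row_stab hP); rewrite xE inE.
Qed.

Lemma full_root_few_elations H : odd q -> large_subgroup H ->
  (#|H :&: elations F| <= q)%N -> root02 1 \in H -> forall t, root02 t \in H.
Proof.
move=> oddq lH eq rH; have [sfH sHS _] := lH.
have ltP := large_parabolic oddq lH.
have q1 : (1 < q)%N := card_finNzRing_gt1 F.
(* Either some elation in [H] has a centre other than that of [root02 1], or all nontrivial ones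
   share this centre. *)
have [/exists_inP[x /setIP[xH xE] x12]|/exists_inPn noE] :=
  boolP [exists x in H :&: elations F, mx3 x o1 o2 != 0].
  move=> t.
  (* The class of [root02 1] under [H :&: PB F] has at most |H ∩ E| - 1 <= q - 1 elements, so
     [large_parabolic] makes the centralizer large. *)
  have leK : (q * #|H :&: elations F| <= #|'C_H[root02 (1 : F)]%g|)%N.
    rewrite leqNgt; apply/negP=> ltK.
    have := card_PB_centralizer sHS (subset_leq_card (class_root02_sub rH (root02_elations 1) root02_neq1)).
    have : (0 < #|H :&: elations F|)%N by apply/card_gt0P; exists x; rewrite inE xH.
    have := cardsD1 1%g (H :&: elations F).
    rewrite (_ : 1%g \in _) /=; last by rewrite inE group1; apply/elationsP; rewrite !mx3_1E.
    move: ltK eq ltP; rewrite -mulnn; move: #|_ :\ _| #|'C_H[_]%g| #|H :&: elations F| #|H :&: PB F|; nia.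
  (* Conjugating [x] by this [h] adds (t / x_12) x_12 = t to the entry (0, 2) and keeps the entry
     (1, 2); the quotient of the two elations is therefore [root02 t]. *)
  have [h [/setIP[hH hC] h00 h01]] := centralizer_transvections oddq sfH sHS leK (t / mx3 x o1 o2).
  have hP := cent_root02_1_parabolic (subsetP sHS _ hH) hC.
  have [h10 h20 h21 h22] := cent_root02_1P _ hC.
  have h11 : mx3 h o1 o1 = 1.
    by have := parabolic_det hP; rewrite h10 -h22 h00 => <-; ring.
  have [y Ey] : exists y, (y * h = h * x)%g by exists (h * x * h^-1)%g; rewrite mulgKV.
  have yE : y \in elations F.
    rewrite -(elationsJ _ (parabolic_row_stab hP)).
    by have -> : (y ^ h = x)%g by apply: (mulgI h); rewrite -conjgC.
  have yH : y \in H by rewrite -(groupMr y hH) Ey groupM.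
  have [[y00 y11 y22] [y01 y10 y20 y21]] := elationsP _ yE.
  have [[x00 x11 x22] [x01 x10 x20 x21]] := elationsP _ xE.
  have E02 := congr1 (fun z : gT => mx3 z o0 o2) Ey.
  have E12 := congr1 (fun z : gT => mx3 z o1 o2) Ey.
  move: E02 E12; rewrite !mx3ME y00 y01 y10 y11 -h22 h00 h01 h10 h11 x22 => E02 E12.
  suff -> : root02 t = (x^-1 * y)%g by rewrite groupM ?groupV.
  apply: (canRL (mulKg x)).
  have [xrE xr0 xr1] := elations_mul xE (root02_elations t).
  apply: elations_eq => //; rewrite ?xr0 ?xr1 root02E mxE /=.
    rewrite -{1}(divfK x12 t); apply: (addrI (mx3 h o0 o2)).
    by move: E02; rewrite mul0r addr0 mulr1 mul1r => ->; ring.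
  rewrite addr0; apply: (addrI (mx3 h o1 o2)).
  by move: E12; rewrite !mul0r !mul1r add0r mulr1 => ->; ring.
move=> t; apply/negPn/negP=> tA.
(* Here [H :&: PB F] fixes the common centre, and conjugation by [h] multiplies the parameters in
   [A] by h_00 / h_22. If [A] were proper, [AGL_bound] would give |A| |C| < q, hence |H ∩ P| <= |K|
   |C| <= q (q - 1) |A| |C| < q^2 (q - 1), against [large_parabolic]. *)
pose A := [set s | root02 s \in H].
pose C := [set mx3 h o0 o0 / mx3 h o2 o2 | h in H :&: PB F].
have {noE}xE0 x : x \in H -> x \in elations F -> x = root02 (mx3 x o0 o2).
  move=> xH xE; apply: root02_eq => //.
  have xHE : x \in H :&: elations F by apply/setIP.
  by have := noE x xHE; rewrite negbK => /eqP.
have conjH h s : h \in H -> h \in PB F -> root02 s \in H ->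
    exists s', [/\ root02 s' \in H & (root02 s' * h = h * root02 s)%g].
  move=> hH hP sH; have [y Ey] : exists y, (y * h = h * root02 s)%g.
    by exists (h * root02 s * h^-1)%g; rewrite mulgKV.
  have yH : y \in H by rewrite -(groupMr y hH) Ey groupM.
  have yE : y \in elations F.
    rewrite -(elationsJ _ (parabolic_row_stab hP)).
    have -> : (y ^ h = root02 s)%g by apply: (mulgI h); rewrite -conjgC.
    exact: root02_elations.
  by exists (mx3 y o0 o2); rewrite -xE0.
have nz h : h \in H :&: PB F ->
    [/\ mx3 h o1 o0 = 0, mx3 h o2 o0 = 0, mx3 h o2 o1 = 0, mx3 h o0 o0 != 0 & mx3 h o2 o2 != 0].
  case/setIP=> hH hP; have [_ h20 h21] := parabolicP _ hP.
  have [s [sH /(congr1 (fun z => mx3 z o1 o2))]] := conjH h 1 hH hP rH.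
  rewrite !mx3ME !root02E !mxE /= !mul0r mul1r !mulr0 !mulr1 add0r !addr0.
  rewrite -{1}[mx3 h o1 o2]add0r => /addIr h10.
  have := row_stab_det (parabolic_row_stab hP).
  by rewrite -h10 mulr0 subr0 !mulf_eq0 !negb_or -andbA => /and3P[].
have ltAC : (#|A| * #|C| < q)%N.
  apply: (AGL_bound (f := t)).
  - move=> s s'; rewrite !inE => sH s'H.
    by rewrite -(groupMr _ s'H) -root02D subrK.
  - by move=> _ /imsetP[h /nz[_ _ _ h0 h2] ->]; rewrite mulf_neq0 ?invr_neq0.
  - move=> _ _ /imsetP[x xK ->] /imsetP[y yK ->].
    have [z Ez] : exists z, (z * y = x)%g by exists (x * y^-1)%g; rewrite mulgKV.
    have zK : z \in (H :&: PB F)%G by rewrite -(groupMr z yK) Ez.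
    apply/imsetP; exists z => //; rewrite -Ez.
    have [y10 y20 y21 y0 y2] := nz _ yK; have [z10 z20 z21 z0 z2] := nz _ zK.
    rewrite !mx3ME y10 y20 z20 z21; field; exact/and3P.
  - move=> _ s /imsetP[h hK ->]; rewrite !inE => sH.
    have [hH hP] := setIP hK.
    have [h10 h20 h21 h0 h2] := nz _ hK.
    have [s' [s'H /(congr1 (fun z => mx3 z o0 o2))]] := conjH h s hH hP sH.
    rewrite !mx3ME !root02E !mxE /= !mul1r mul0r mulr0 !addr0 mulr1 [RHS]addrC => /addrI Es.
    by rewrite mulrAC -Es mulfK.
  - by rewrite inE.
pose K := 'C_H[root02 (1 : F)]%G.
have leHC : (#|H :&: PB F| <= #|K| * #|C|)%N.
  apply: (@card_le_fibers _ _ _ _ _ (fun h : gT => mx3 h o0 o0 / mx3 h o2 o2)).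
    by move=> h hK; apply: imset_f.
  move=> x y xK yK E.
  have [z Ez] : exists z, y = (x * z)%g by exists (x^-1 * y)%g; rewrite mulKVg.
  have zK : z \in (H :&: PB F)%G by rewrite -(groupMl z xK) -Ez.
  have -> : (x^-1 * y)%g = z by rewrite Ez mulKg.
  have [x10 x20 x21 x0 x2] := nz _ xK; have [z10 z20 z21 z0 z2] := nz _ zK.
  apply/setIP; split; first by have [] := setIP zK.
  apply/cent_root02_1P; split=> //.
  move: E; rewrite Ez !mx3ME x20 x21 z10 z20 => E.
  have D : mx3 x o0 o0 / mx3 x o2 o2 != 0 by rewrite mulf_neq0 ?invr_neq0.
  apply: (divIf z2); rewrite divff //; apply: (mulfI D); rewrite mulr1 [RHS]E.
  by field; apply/andP.
(* On the centralizer the entries (0, 0) and (0, 1) determine the whole 2x2 block, and each fibre is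
   a coset of elations of [H], which [A] parametrizes. *)
have leK : (#|K| <= #|A| * (q * (q - 1)))%N.
  apply: (@leq_trans (#|H :&: elations F| * (q * (q - 1)))).
    rewrite [(q * _)%N]mulnC -(card_nz F) -cardsT -cardsX.
    have KP x : x \in K -> [/\ x \in H, x \in PB F, mx3 x o1 o0 = 0,
        mx3 x o0 o0 ^+ 2 * mx3 x o1 o1 = 1 & mx3 x o0 o0 != 0].
      case/setIP=> xH xC; have xP := cent_root02_1_parabolic (subsetP sHS _ xH) xC.
      have [x10 _ _ x22] := cent_root02_1P _ xC.
      have D : mx3 x o0 o0 ^+ 2 * mx3 x o1 o1 = 1.
        by rewrite -(parabolic_det xP) x10 -x22; ring.
      by split=> //; apply: contra_eq_neq D => ->; rewrite expr0n mul0r eq_sym oner_neq0.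
    apply: (@card_le_fibers _ _ _ _ _ (fun h : gT => (mx3 h o0 o0, mx3 h o0 o1))).
      by move=> h /KP[_ _ _ _ h0]; rewrite !inE /= h0.
    move=> x y /KP[xH xP x10 dx x0] /KP[yH yP y10 dy y0] [E0 E1].
    rewrite inE groupM ?groupV //; apply: parabolic_same_block; rewrite ?x10 ?y10 //.
    by apply: (mulfI (expf_neq0 2 x0)); rewrite dx E0 dy.
  rewrite leq_mul2r; apply/orP; right.
  have injE : {in H :&: elations F &, injective (fun x => mx3 x o0 o2)}.
    by move=> x y /setIP[xH xE] /setIP[yH yE] E; rewrite (xE0 x) // (xE0 y) // E.
  rewrite -(card_in_imset injE); apply: subset_leq_card.
  by apply/subsetP=> _ /imsetP[x /setIP[xH xE] ->]; rewrite inE -xE0.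
move: ltAC leHC leK ltP; rewrite -mulnn.
move: #|A| #|C| #|K| #|_ :&: _|; nia.
Qed.
(** Now [root02 1] lies outside [H], but its class under [H :&: PB F] still consists of nontrivial
    elations. It has at most q^2 - 1 elements, so the centralizer in [H] has more than 2 (q - 1) >=
    q. *)
Lemma large_upper_unipotent H : odd q -> large_subgroup H ->
  (#|H :&: elations F| <= 1)%N -> forall b, exists x,
  [/\ x \in H, mx3 x o0 o0 = 1, mx3 x o1 o1 = 1, mx3 x o2 o2 = 1 &
  [/\ mx3 x o0 o1 = b, mx3 x o1 o0 = 0, mx3 x o2 o0 = 0 & mx3 x o2 o1 = 0]].
Proof.
move=> oddq lH e1 b; have [sfH sHS _] := lH.
have ltP := large_parabolic oddq lH.
have q1 : (1 < q)%N := card_finNzRing_gt1 F.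
have leK : (q * #|H :&: elations F| <= #|'C_H[root02 (1 : F)]%g|)%N.
  have le : (#|(root02 (1 : F) ^: (H :&: PB F))%g| <= q ^ 2 - 1)%N.
    apply: (@leq_trans #|elations F :\ 1%g|).
      apply: subset_leq_card; apply/subsetP=> _ /imsetP[h /setIP[hH hP] ->].
      rewrite !inE conjg_eq1 root02_neq1 /=.
      by have := elationsJ (root02 1) (parabolic_row_stab hP); rewrite root02_elations inE.
    have := cardsD1 1%g (elations F).
    rewrite (_ : 1%g \in _) /=; last by apply/elationsP; rewrite !mx3_1E.
    by have := card_elations_le F => le2 E; rewrite E add1n in le2; rewrite -ltnS subn1 (ltn_predK le2).
  have := card_PB_centralizer sHS le; rewrite leqNgt; move: ltP e1 => ltP e1 le1.
  apply/negP=> ltK; move: ltP e1 le1 ltK; rewrite -mulnn.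
  move: #|'C_H[_]%g| #|H :&: elations F| #|H :&: PB F|; nia.
have [x [/setIP[xH xC] x00 x01]] := centralizer_transvections oddq sfH sHS leK b.
have xP := cent_root02_1_parabolic (subsetP sHS _ xH) xC.
have [x10 x20 x21 x22] := cent_root02_1P _ xC.
have x11 : mx3 x o1 o1 = 1.
  by have := parabolic_det xP; rewrite x10 -x22 x00 => <-; ring.
by exists x; rewrite -x22; split.
Qed.

Lemma full_root_no_elations H : odd q -> large_subgroup H ->
  (#|H :&: elations F| <= 1)%N ->
  exists s, forall b, exists2 x, x \in H & mx3 x = m33 1 b (s * b) 0 1 0 0 0 1.
Proof.
move=> oddq lH e1; have [sfH sHS _] := lH.
(* Swapping the first two coordinates turns the upper transvections found in [H :^ w] into lower
   ones in [H]. *)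
pose w : gT := toGL (m33 0 1 0 1 0 0 0 0 1).
have wE : mx3 w = m33 0 1 0 1 0 0 0 0 1.
  by rewrite toGL_m33 // (_ : _ + _ = - 1) ?oppr_eq0 ?oner_eq0 //; ring.
have wS : w \in row_stab F by apply/row_stabP; rewrite wE !mxE.
have e1w : (#|(H :^ w)%G :&: elations F| <= 1)%N by rewrite card_conj_elations.
have [x [xH x00 x11 x22 [x01 x10 x20 x21]]] := large_upper_unipotent oddq lH e1 1.
have [y' [y'H y00 y11 y22 [y01 y10 y20 y21]]] :=
  large_upper_unipotent oddq (large_subgroupJ w lH) e1w (-1).
have [y [yH [{y00}y00 {y11}y11 {y22}y22] [{y01}y01 {y10}y10 {y20}y20 {y21}y21]]] :
    exists y, [/\ y \in H, [/\ mx3 y o0 o0 = 1, mx3 y o1 o1 = 1 & mx3 y o2 o2 = 1] &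
    [/\ mx3 y o0 o1 = 0, mx3 y o1 o0 = -1, mx3 y o2 o0 = 0 & mx3 y o2 o1 = 0]].
  move: y'H; rewrite mem_conjg => yH; exists (y' ^ w^-1)%g.
  have /(congr1 (@mx3 F))/matrixP E : ((y' ^ w^-1) * w = w * y')%g.
    by rewrite conjgE invgK mulgA mulgKV.
  move: (y' ^ w^-1)%g yH E => y yH E; split=> //.
    by have := E o0 o1; have := E o1 o0; have := E o2 o2;
      rewrite !mx3ME wE !mxE /= ?y00 ?y11 ?y22 ?y01 ?y10 ?y20 ?y21;
      rewrite ?(mulr0, mulr1, mul0r, mul1r, add0r, addr0).
  by have := E o0 o0; have := E o1 o1; have := E o2 o1; have := E o2 o0;
      rewrite !mx3ME wE !mxE /= ?y00 ?y11 ?y22 ?y01 ?y10 ?y20 ?y21;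
      rewrite ?(mulr0, mulr1, mul0r, mul1r, add0r, addr0).
(* [x y x] acts on the first two coordinates as a Weyl element, so its square [j] acts as -1. *)
pose z := (x * y * x)%g.
have [j [jH [j00 j11 j22] [j01 j10 j20 j21]]] :
    exists j, [/\ j \in H, [/\ mx3 j o0 o0 = -1, mx3 j o1 o1 = -1 & mx3 j o2 o2 = 1] &
    [/\ mx3 j o0 o1 = 0, mx3 j o1 o0 = 0, mx3 j o2 o0 = 0 & mx3 j o2 o1 = 0]].
  exists (z * z)%g; split; first by rewrite !groupM.
    by split; rewrite !mx3ME ?x00 ?x11 ?x22 ?x01 ?x10 ?x20 ?x21 ?y00 ?y11 ?y22 ?y01 ?y10 ?y20 ?y21; ring.
  by split; rewrite !mx3ME ?x00 ?x11 ?x22 ?x01 ?x10 ?x20 ?x21 ?y00 ?y11 ?y22 ?y01 ?y10 ?y20 ?y21; ring.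
have jP : j \in PB F by apply/parabolicP; split=> //; apply: (subsetP sHS).
(* This value solves the entry (0, 2) of j h = h j for h_02; it depends on [j] only. *)
exists (- mx3 j o1 o2 / 2%:R) => b.
have [h [hH h00 h11 h22 [h01 h10 h20 h21]]] := large_upper_unipotent oddq lH e1 b.
have hP : h \in PB F by apply/parabolicP; split=> //; apply: (subsetP sHS).
(* On the 2x2 block [j] is -1, so j h and h j differ by an elation in [H], which is trivial. *)
have Ejh : (j * h = h * j)%g.
  apply: (mulgI (j * h)^-1%g); rewrite mulVg.
  have oE : 1%g \in H :&: elations F.
    by rewrite in_setI group1; apply/elationsP; rewrite !mx3_1E.
  apply: (card_le1_eqP e1) => //.
  rewrite in_setI groupM ?groupV ?groupM //=.
  apply: parabolic_same_block; rewrite ?groupM // !mx3ME;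
    by rewrite ?j00 ?j11 ?j01 ?j10 ?h00 ?h11 ?h01 ?h10 ?h20 ?h21 ?j20 ?j21; ring.
exists h => //.
have E02 := congr1 (fun u => mx3 u o0 o2) Ejh.
have E12 := congr1 (fun u => mx3 u o1 o2) Ejh.
move: E02 E12; rewrite !mx3ME j00 j11 j22 j01 j10 h00 h11 h22 h01 h10.
rewrite !mulr1 !mul1r !mul0r !addr0 !add0r !mulN1r => E02 E12.
have t2 := two_neq0 oddq.
have h12 : mx3 h o1 o2 = 0.
  apply: (mulfI t2); rewrite mulr0.
  have -> : 0 = mx3 j o1 o2 + mx3 h o1 o2 - (- mx3 h o1 o2 + mx3 j o1 o2) by rewrite E12; ring.
  by ring.
have h02 : mx3 h o0 o2 = - mx3 j o1 o2 / 2%:R * b.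
  apply: (mulfI t2); rewrite [RHS](_ : _ = - (b * mx3 j o1 o2)); last by field.
  have -> : 2%:R * mx3 h o0 o2 = mx3 j o0 o2 + b * mx3 j o1 o2 + mx3 h o0 o2
     - (- mx3 h o0 o2 + mx3 j o0 o2) - b * mx3 j o1 o2 by ring.
  by rewrite -E02; ring.
by apply/matrixP; do 2 apply: ord3_ind; rewrite !mxE.
Qed.
End FewElations.

(** * Counting the elations of a subgroup centre by centre *)

Section LineTraces.
Local Open Scope ring_scope.
Variable F : finFieldType.
Local Notation q := #|F|.
Local Notation gT := (GL3 F).
Implicit Types (x y z g h : gT) (H : {group gT}).

Definition elation (v : F * F) : gT := toGL (m33 1 0 v.1 0 1 v.2 0 0 1).

Lemma elationE v : mx3 (elation v) = m33 1 0 v.1 0 1 v.2 0 0 1.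
Proof. by rewrite toGL_m33 // (_ : _ - _ + _ = 1) ?oner_neq0 //; ring. Qed.

Lemma elation_elations v : elation v \in elations F.
Proof. by apply/elationsP; rewrite elationE !mxE. Qed.

Lemma elationK x : x \in elations F -> elation (mx3 x o0 o2, mx3 x o1 o2) = x.
Proof.
by move=> xE; apply: elations_eq; rewrite ?elation_elations // elationE !mxE.
Qed.

Lemma elation_inj : injective elation.
Proof.
move=> [a b] [c d] /(congr1 (@mx3 F)); rewrite !elationE => /matrixP E.
by have := E o0 o2; have := E o1 o2; rewrite !mxE /= => -> ->.
Qed.

Lemma elationD v w : elation (v + w) = (elation v * elation w)%g.
Proof.
have [E E0 E1] := elations_mul (elation_elations v) (elation_elations w).
by apply: elations_eq; rewrite ?elation_elations ?E0 ?E1 // !elationE !mxE.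
Qed.

Lemma elations_group_set : group_set (elations F).
Proof.
apply/group_setP; split; first by apply/elationsP; rewrite !mx3_1E.
by move=> x y xE yE; have [] := elations_mul xE yE.
Qed.

Definition elations_group := Group elations_group_set.

Lemma card_elations : #|elations F| = (q ^ 2)%N.
Proof.
rewrite -mulnn -card_prod -(card_imset _ elation_inj); apply: eq_card => x.
apply/idP/imsetP=> [xE|[v _ ->]]; last exact: elation_elations.
by exists (mx3 x o0 o2, mx3 x o1 o2) => //; rewrite elationK.
Qed.

Lemma elation0 : elation 0 = 1%g.
Proof.
apply: mx3_eq; do 2 apply: ord3_ind; by rewrite elationE mx3_1E !mxE.
Qed.

Lemma elation_root02 t : elation (t, 0) = root02 t.
Proof. by []. Qed.

Definition scale2 (t : F) (v : F * F) : F * F := (t * v.1, t * v.2).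

Lemma scale2_inj t : t != 0 -> injective (scale2 t).
Proof. by move=> t0 [a b] [c d] [/(mulfI t0)-> /(mulfI t0)->]. Qed.

Definition elation_vectors H := [set v | elation v \in H].

(** Parametrizes the intersection of [H] with the root subgroup of centre [v]. For v = 0 it is the
    whole field, so the counts below range over nonzero [v]. *)
Definition line_trace H v := [set t | elation (scale2 t v) \in H].

Lemma card_elation_vectors H : #|elation_vectors H| = #|H :&: elations F|.
Proof.
rewrite -(card_imset _ elation_inj); apply: eq_card => x.
apply/imsetP/setIP=> [[v + ->]|[xH xE]].
  by rewrite inE; split=> //; apply: elation_elations.
by exists (mx3 x o0 o2, mx3 x o1 o2); rewrite ?inE elationK.
Qed.

Lemma elationJ_scale h v w t : h \in row_stab F -> (elation v ^ h = elation w)%g ->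
  (elation (scale2 t v) ^ h = elation (scale2 t w))%g.
Proof.
move=> hS E.
have E' : (elation v * h = h * elation w)%g by rewrite -E conjgC.
have [h20 h21] := row_stabP _ hS.
have E1 := congr1 (fun u => mx3 u o0 o2) E'; have E2 := congr1 (fun u => mx3 u o1 o2) E'.
move: E1 E2; rewrite !mx3ME !elationE !mxE /= => E1 E2.
apply: (mulgI h); rewrite -conjgC; apply: mx3_eq.
do 2 apply: ord3_ind; rewrite !mx3ME !elationE !mxE /= ?h20 ?h21; try ring.
  transitivity (mx3 h o0 o2 + t * (1 * mx3 h o0 o2 + 0 * mx3 h o1 o2 + v.1 * mx3 h o2 o2
    - mx3 h o0 o2)); [ring | rewrite E1; ring].
transitivity (mx3 h o1 o2 + t * (0 * mx3 h o0 o2 + 1 * mx3 h o1 o2 + v.2 * mx3 h o2 o2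
  - mx3 h o1 o2)); [ring | rewrite E2; ring].
Qed.

Lemma line_traceJ H h v w : h \in row_stab F -> (elation v ^ h = elation w)%g ->
  line_trace (H :^ h)%G w = line_trace H v.
Proof.
move=> hS E; apply/setP=> t; rewrite !inE -(elationJ_scale t hS E).
by rewrite memJ_conjg.
Qed.

Lemma line_trace_scale H s v : s != 0 ->
  #|line_trace H (scale2 s v)| = #|line_trace H v|.
Proof.
move=> s0; rewrite -(card_imset (mem (line_trace H v)) (mulfI (invr_neq0 s0))).
apply: eq_card => t; rewrite inE; apply/idP/imsetP => [tH|[r + ->]].
  exists (s * t); last by rewrite mulKf.
  rewrite inE (_ : scale2 (s * t) v = scale2 t (scale2 s v)) //.
  by rewrite /scale2 /=; congr (_, _); ring.
rewrite !inE (_ : scale2 (s^-1 * r) _ = scale2 r v) //.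
by rewrite /scale2 /=; congr (_, _); field.
Qed.

Definition trace_class H r := [set v : F * F | (v != 0) && (#|line_trace H v| == r)].

(** Conjugation by [x] generates a p-group permuting the vectors with trace of size [r]. Its fixed
    points are the nonzero multiples of (1, 0), which all have the same trace size, so they
    contribute q - 1 or nothing. *)
Lemma card_trace_class_mod H (p r : nat) (t : F) x : p \in [pchar F] -> t != 0 -> x \in H ->
  mx3 x = m33 1 t 0 0 1 0 0 0 1 ->
  #|trace_class H r| =
    (if #|line_trace H (1 : F, 0 : F)%R| == r then q - 1 else 0)%N %[mod p].
Proof.
move=> chp t0 xH xE.
have xS : x \in row_stab F by apply/row_stabP; rewrite xE !mxE.
have xp : (x ^+ p = 1)%g.
  have xn n : mx3 (x ^+ n)%g = m33 1 (n%:R * t) 0 0 1 0 0 0 1.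
    elim: n => [|n IHn]; apply/matrixP; do 2 apply: ord3_ind;
      rewrite ?expg0 ?expgS ?mx3_1E ?mx3ME ?IHn ?xE !mxE /= -?natr1; ring.
  apply: mx3_inj; rewrite xn (pcharf0 chp) mul0r mx3_1.
  by apply/matrixP; do 2 apply: ord3_ind; rewrite !mxE.
have pr_p := pcharf_prime chp.
have pX : (p.-group <[x]>)%g.
  rewrite /pgroup -orderE; apply: (@pnat_dvd _ p); first by rewrite order_dvdn xp.
  by rewrite pnat_id.
pose S := elation @: trace_class H r.
have xJ v : (elation v ^ x = elation (v.1 - t * v.2, v.2))%g.
  apply: (mulgI x); rewrite -conjgC; apply: mx3_eq.
  by do 2 apply: ord3_ind; rewrite !mx3ME !elationE xE !mxE /=; ring.
(* The fixed points of [x] on [S] are the elations along the line of [(1, 0)]. *)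
have actS : [acts <[x]>, on S | 'J]%g.
  rewrite cycle_subG; apply/setIP; split; rewrite inE //.
  apply/subsetP=> _ /imsetP[v vS ->].
  rewrite inE /= xJ; apply: imset_f; move: vS; rewrite !inE.
  rewrite -(line_traceJ H xS (xJ v)) (_ : (H :^ x)%G = H); last first.
    by apply: val_inj; rewrite /= conjGid.
  case/andP=> v0 ->; rewrite andbT; apply: contra v0; case: v => a b.
  by rewrite !xpair_eqE /= => /andP[+ /eqP b0]; rewrite b0 mulr0 subr0 eqxx andbT.
rewrite -(card_imset _ elation_inj) -/S (pgroup_fix_mod pX actS).
congr (_ %% _)%N.
rewrite afixJ cent_cycle.
pose L := if #|line_trace H (1 : F, 0 : F)%R| == r then [set c : F | c != 0] else set0.
have -> : (if #|line_trace H (1 : F, 0 : F)%R| == r then q - 1 else 0)%N = #|L|.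
  by rewrite /L; case: ifP; rewrite ?cards0 ?card_nz.
have injL : injective (fun c : F => elation (c, 0)) by move=> c d /elation_inj[].
rewrite -(card_imset _ injL); apply: eq_card => z.
have LE c : (c \in L) = (c != 0) && (#|line_trace H (c, 0)| == r).
  have [-> |c0] := eqVneq c 0; first by rewrite /L; case: ifP; rewrite !inE ?eqxx.
  rewrite -[(c, 0)](_ : scale2 c (1 : F, 0 : F)%R = _); last by rewrite /scale2 /= mulr1 mulr0.
  by rewrite line_trace_scale // /L; case: ifP; rewrite !inE.
apply/setIP/imsetP=> [[/imsetP[v vS ->] /cent1P cx]|[c cL ->]].
  have v2 : v.2 = 0.
    have /elation_inj/(congr1 fst)/= : elation (v.1 - t * v.2, v.2) = elation v.
      by rewrite -xJ conjgE cx mulKg.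
    rewrite -[RHS]subr0 => /addrI/oppr_inj/eqP.
    by rewrite mulf_eq0 (negPf t0) => /eqP.
  exists v.1; last by case: v v2 {vS cx} => a b /= ->.
  move: vS; rewrite inE LE; case: v v2 {cx} => a b /= ->.
  by rewrite xpair_eqE eqxx andbT.
rewrite imset_f; last first.
  by move: cL; rewrite LE inE xpair_eqE eqxx andbT.
split=> //; apply/cent1P; have := xJ (c, 0); rewrite /= mulr0 subr0 => E.
by rewrite /commute [RHS]conjgC E || rewrite /commute [LHS]conjgC E.
Qed.

(** Double counting of the pairs (v, t) of nonzero [v] and [t] with t v in [elation_vectors H]; for
    fixed [t], scaling by [t] is a bijection. *)
Lemma card_line_traces H :
  (\sum_(v : F * F | v != 0%R) (#|line_trace H v| - 1) =
   (q - 1) * (#|elation_vectors H| - 1))%N.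
Proof.
pose A := elation_vectors H.
have c1 v : (#|line_trace H v| - 1 = \sum_(t : F | t != 0%R) (scale2 t v \in A))%N.
  have := cardsD1 0 (line_trace H v).
  rewrite (_ : 0 \in _ = true) => [->|]; last first.
    by rewrite inE (_ : scale2 0 v = 0) ?elation0 ?group1 // /scale2 !mul0r.
  rewrite addKn -sum1_card big_mkcond [RHS]big_mkcond /=; apply: eq_bigr => t _.
  by rewrite !inE; case: (t == 0); case: (_ \in H).
rewrite (eq_bigr _ (fun v _ => c1 v)) exchange_big /=.
rewrite -(card_nz F) -sum_nat_const; apply: eq_big => [t|t t0]; first by rewrite inE.
pose O : F * F := 0.
have := cardsD1 O A; rewrite (_ : O \in A = true); last by rewrite inE elation0 group1.
move=> ->; rewrite addKn -(card_imset _ (scale2_inj (invr_neq0 t0))).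
rewrite -sum1_card big_mkcond [RHS]big_mkcond /=; apply: eq_bigr => v _.
have [v0|v0] := eqVneq v 0.
  case: imsetP => // -[w]; rewrite !inE => /andP[/eqP w0 _] E; case: w0.
  apply: (scale2_inj (invr_neq0 t0)); rewrite -E v0.
  by rewrite /scale2 !mulr0.
have -> : (v \in scale2 t^-1 @: (A :\ O)) = (scale2 t v \in A).
  apply/imsetP/idP=> [[w /setD1P[_ wA] ->]|tvA].
    by rewrite (_ : scale2 t _ = w) //; case: (w) => a b; rewrite /scale2 /= !mulVKf.
  exists (scale2 t v); last by case: (v) => a b; rewrite /scale2 /= !mulKf.
  rewrite !inE in tvA *; rewrite tvA andbT; apply: contra v0 => /eqP E.
  by apply/eqP/(scale2_inj t0); rewrite E /scale2 !mulr0.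
by case: (_ \in A).
Qed.
End LineTraces.

(** * Subgroups with more than q elations for every axis *)

Section ManyElations.
Local Open Scope ring_scope.
Variable F : finFieldType.
Local Notation q := #|F|.
Local Notation gT := (GL3 F).
Implicit Types (x y z g h : gT) (H : {group gT}).

Lemma card_trace_class_le H g r : g \in row_stab F ->
  (#|trace_class H r| <= #|trace_class (H :^ g)%G r|)%N.
Proof.
move=> gS; rewrite -(card_imset _ (@elation_inj F)) -(cardJg _ g).
rewrite -[leqRHS](card_imset _ (@elation_inj F)); apply: subset_leq_card.
apply/subsetP=> _ /imsetP[_ /imsetP[v + ->] ->].
have vE := elation_elations v.
have vgE : (elation v ^ g)%g \in elations F by rewrite elationsJ.
have := elationK vgE; move: (_, _) => w Ew; rewrite -Ew !inE => /andP[v0 vr].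
apply: imset_f; rewrite inE (line_traceJ H gS (esym Ew)) vr andbT.
apply: contra v0 => /eqP w0; move: Ew; rewrite w0 elation0 => /esym/eqP.
by rewrite conjg_eq1 -elation0 (inj_eq (@elation_inj F)).
Qed.

Lemma card_trace_classJ H g r : g \in row_stab F ->
  #|trace_class (H :^ g)%G r| = #|trace_class H r|.
Proof.
move=> gS; apply/eqP; rewrite eqn_leq card_trace_class_le // andbT.
apply: leq_trans (card_trace_class_le _ _ (row_stabV gS)) _.
by rewrite (_ : ((H :^ g)%G :^ g^-1)%G = H) //; apply: val_inj; rewrite /= conjsgK.
Qed.

Lemma full_root_many_elations H :
  (forall g, (q < #|(H :^ g)%G :&: elations F|)%N) -> forall t, root02 t \in H.
Proof.
move=> many; have q1 : (1 < q)%N := card_finNzRing_gt1 F.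
(* There are more than q elations but only q values for the entry (1, 2). Two elations agree there,
   and their quotient is a nontrivial [root02 t]. *)
have nontriv g : exists2 t, t != 0 & root02 t \in (H :^ g)%G.
  have /injectivePn : ~~ injectiveb (fun z : {z | z \in (H :^ g)%G :&: elations F} => mx3 (val z) o1 o2).
    apply/negP=> /injectiveP/leq_card; rewrite card_sig leqNgt.
    by rewrite (_ : #|_| = #|(H :^ g)%G :&: elations F|) ?many //; apply: eq_card => z; rewrite inE.
  case=> -[x xA] [[y yA] xy /= E]; have [xH xE] := setIP xA; have [yH yE] := setIP yA.
  have zE : (x^-1 * y)%g \in elations F.
    have [[x00 x11 x22] [x01 x10 x20 x21]] := elationsP _ xE.
    have [[y00 y11 y22] [y01 y10 y20 y21]] := elationsP _ yE.
    by apply: parabolic_same_block; rewrite ?x00 ?x01 ?x10 ?x11 //; apply: elations_parabolic.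
  have zH : (x^-1 * y)%g \in (H :^ g)%G by rewrite groupM ?groupV.
  have [_ _] := elations_mul xE zE; rewrite mulKVg -E.
  rewrite -{1}[mx3 x o1 o2]addr0 => /addrI/esym z12.
  exists (mx3 (x^-1 * y)%g o0 o2); last by rewrite -root02_eq.
  apply: contra xy => /eqP z02; apply/eqP/val_inj => /=.
  have z1 : (x^-1 * y)%g = 1%g by rewrite (root02_eq zE z12) z02 -elation_root02 elation0.
  by apply/esym; rewrite -(mulKVg x y) z1 mulg1.
have [p pr_p chp] := finPcharP F.
have p_q : (p %| q)%N by rewrite (dvdn_pcharf chp) card_natr0.
(* Conjugation moves [v] to (1, 0). The transvection needed by [card_trace_class_mod] comes from
   [nontriv] for a further conjugate: the swap [w] of the last two coordinates turns [root02 t] into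
   1 + t E_01, indices starting at 0. *)
have cls v r : v != 0 -> #|trace_class H r| =
    (if #|line_trace H v| == r then q - 1 else 0)%N %[mod p].
  move=> v0.
  have [g gS Eg] : exists2 g, g \in row_stab F & (elation v ^ g = elation (1%R, 0%R))%g.
    apply: elations_conj_root02; first exact: elation_elations.
    by apply: contra v0 => /eqP; rewrite -elation0 => /elation_inj ->.
  rewrite -(card_trace_classJ H r gS) -(line_traceJ H gS Eg).
  pose w : gT := toGL (m33 1 0 0 0 0 1 0 1 0).
  have wE : mx3 w = m33 1 0 0 0 0 1 0 1 0.
    by rewrite toGL_m33 // (_ : _ + _ = - 1) ?oppr_eq0 ?oner_eq0 //; ring.
  have [t t0 tH] := nontriv (g * w)%g.
  apply: (@card_trace_class_mod _ _ p r t (root02 t ^ w^-1)%g) => //.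
    by move: tH; rewrite /= conjsgM mem_conjg.
  pose y : gT := toGL (m33 1 t 0 0 1 0 0 0 1).
  have yE : mx3 y = m33 1 t 0 0 1 0 0 0 1.
    by rewrite toGL_m33 // (_ : _ + _ = 1) ?oner_eq0 //; ring.
  rewrite -yE; congr mx3; apply: (mulIg w); rewrite conjgE invgK mulgA mulgKV.
  by apply: mx3_eq; do 2 apply: ord3_ind; rewrite !mx3ME wE yE root02E !mxE /=; ring.
have q10 : (q - 1 = 0 %[mod p])%N -> False.
  move=> /eqP; rewrite eqn_mod_dvd // subn0 => p_q1.
  have := dvdn_sub p_q p_q1; rewrite subKn ?(ltnW q1) // dvdn1 => /eqP p1.
  by rewrite p1 in pr_p.
pose r := #|line_trace H (1%R, 0%R)|.
have e10 : ((1 : F), (0 : F)) != 0 :> (F * F)%type.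
  by rewrite xpair_eqE oner_eq0.
(* If the trace sizes at [v] and at (1, 0) differed, the same class would have q - 1 elements modulo
   p by one count and 0 by the other. *)
have rE v : v != 0 -> #|line_trace H v| = r.
  move=> v0; apply/eqP; apply/negPn/negP=> vr; apply: q10.
  by have := cls _ #|line_trace H v| v0; rewrite (cls _ _ e10) eqxx eq_sym (negPf vr).
pose A := elation_vectors H; have AE := card_elation_vectors H; rewrite -/A in AE.
have cA := card_line_traces H; rewrite -/A in cA.
have nzE : #|[pred v : F * F | v != 0]| = (q ^ 2 - 1)%N.
  by have := cardC1 (0 : (F * F)%type); rewrite card_prod mulnn subn1 => <-.
rewrite (eq_bigr (fun=> (r - 1)%N)) in cA; last by move=> v v0; rewrite rE.
rewrite sum_nat_const nzE in cA.
have dA : (#|A| %| q ^ 2)%N.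
  by rewrite AE -card_elations; exact: (cardSg (subsetIr H (elations_group F))).
have r_q : (r %| q)%N.
  apply: card_add_closed; first by rewrite inE /scale2 !mul0r elation0 group1.
  move=> s t; rewrite !inE => sH tH.
  rewrite (_ : scale2 (s + t) _ = scale2 s (1%R, 0%R) + scale2 t (1%R, 0%R)).
    by rewrite elationD groupM.
  by rewrite /scale2 /= !mulr0 !mulr1 -[RHS]/(_, _) addr0.
have q_A : (q < #|A|)%N.
  by rewrite AE; have := many 1%g; rewrite (_ : (H :^ 1)%G = H) //; apply: val_inj; rewrite /= conjsg1.
(* The count [|A| - 1 = (q + 1)(r - 1)] with [r] and [|A|] powers of [p] forces [r = q]. *)
suff rq : r = q.
  move=> t; have : t \in line_trace H (1%R, 0%R).
    suff -> : line_trace H (1%R, 0%R) = [set: F] by rewrite inE.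
    by apply/eqP; rewrite eqEcard subsetT cardsT /= -/r rq leqnn.
  by rewrite inE /scale2 /= mulr1 mulr0.
have r1 : (1 < r)%N.
  have := nontriv 1%g => -[t t0]; rewrite (_ : (H :^ 1)%G = H) => [tH|]; last first.
    by apply: val_inj; rewrite /= conjsg1.
  rewrite -[X in (X < _)%N](cards1 (0 : F)); apply: proper_card; apply/properP; split.
    by rewrite sub1set inE /scale2 !mul0r elation0 group1.
  by exists t; rewrite inE // /scale2 /= mulr1 mulr0.
have [s Es] := dvdnP r_q.
have [s1|s1] := eqVneq s 1%N; first by rewrite Es s1 mul1n.
have s0 : (0 < s)%N by case: (s) Es q1 => // ->.
(* With q = s r, one has 1 + (q + 1)(r - 1) = r (q + 1 - s). As |A| divides q^2, the factor q + 1 -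
   s is a power of p. *)
have Ae : (#|A| = r * (q + 1 - s))%N.
  have : ((q + 1) * (r - 1) = #|A| - 1)%N.
    apply/eqP; rewrite -(eqn_pmul2l (_ : 0 < q - 1)%N) ?subn_gt0 // -cA mulnA.
    by rewrite -[(q ^ 2 - 1)%N]/(q ^ 2 - 1 ^ 2)%N subn_sqr.
  move: q_A r1; rewrite Es; move: #|A| (r) => m [|r'] // q_A _ Em.
  have -> : (s * r'.+1 + 1 - s = s * r' + 1)%N by rewrite mulnS -addnA addKn.
  have m0 : (0 < m)%N by apply: leq_ltn_trans q_A.
  rewrite -(subnK m0) -Em subn1 /=; lia.
have qpn : p.-nat q.
  by rewrite -(cardsT F); apply: (pprimeChar_pgroup chp).
have pn : p.-nat (q + 1 - s)%N.
  by apply: pnat_dvd (dvdn_trans _ dA) _; rewrite ?Ae ?dvdn_mull // pnatX qpn.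
(* Hence q + 1 - s is 1 modulo p. Being a power of p it equals 1, so s = q and r = 1, which [r1]
   excludes. *)
have p_s : (p %| s)%N.
  have sq : (s %| q)%N by rewrite Es dvdn_mulr.
  have [[|k] Ek] := p_natP (pnat_dvd sq qpn); first by rewrite Ek in s1.
  by rewrite Ek expnS dvdn_mulr.
have sq : (s <= q)%N by rewrite Es leq_pmulr // ltnW.
have [[|k] Ek] := p_natP pn.
  have Eq : s = q by move: Ek sq; rewrite expn0; clear; move: q s => m n; lia.
  by have := @ltn_pmul2l s 1 r s0; rewrite -Es muln1 Eq ltnn r1.
have : (p %| q + 1 - s)%N by rewrite Ek expnS dvdn_mulr.
rewrite addnC -addnBA // dvdn_addl ?dvdn_sub // dvdn1 => /eqP p1.
by rewrite p1 in pr_p.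
Qed.
End ManyElations.

(** * Root subgroups without coordinates, and their existence *)

Section FullRoots.
Local Open Scope ring_scope.
Variable F : finFieldType.
Local Notation q := #|F|.
Local Notation gT := (GL3 F).
Implicit Types (x y z g h : gT) (H : {group gT}).

Implicit Types (u v : 'cV[F]_3) (a b : 'rV[F]_3).

(** Column [u] is the centre and row [a] the axis of the root subgroup; conjugation changes them to
    g u and a g^-1. The incidence a u = 0 is carried separately. *)
Definition full_root H u a :=
  forall t, exists2 x, x \in H & mx3 x = 1%:M + t *: (u *m a).

Lemma mx3V x : mx3 x^-1%g *m mx3 x = 1%:M.
Proof. by rewrite -mx3M mulVg mx3_1. Qed.

Lemma mx3Vr x : mx3 x *m mx3 x^-1%g = 1%:M.
Proof. by rewrite -mx3M mulgV mx3_1. Qed.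

Lemma full_rootJ H g u a :
  full_root (H :^ g)%G u a -> full_root H (mx3 g *m u) (a *m mx3 g^-1%g).
Proof.
move=> fH t; have [x xH Ex] := fH t; exists (x ^ g^-1)%g; first by rewrite -mem_conjg.
rewrite conjgE invgK !mx3M Ex !(mulmxDl, mulmxDr) mul1mx mx3Vr.
by rewrite -scalemxAl -scalemxAr !mulmxA.
Qed.

Lemma full_rootM H h u a : h \in H ->
  full_root H u a -> full_root H (mx3 h *m u) (a *m mx3 h^-1%g).
Proof.
move=> hH fH; apply: full_rootJ; rewrite (_ : (H :^ h)%G = H) //.
by apply: val_inj; rewrite /= conjGid.
Qed.

Lemma full_root_delta H : (forall t, root02 t \in H) ->
  full_root H (delta_mx o0 0) (delta_mx 0 o2).
Proof.
move=> rH t; exists (root02 t) => //; rewrite root02E mul_delta_mx.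
by apply/matrixP; do 2 apply: ord3_ind; rewrite !mxE /=; ring.
Qed.

(** The group [elations] stays fixed and conjugates of [H] stand for the choice of an axis. The
    three cases are: more than q elations for every conjugate, at most one for some conjugate, or an
    intermediate number. *)
Lemma exists_full_root H : odd q -> large_subgroup H ->
  exists u a, [/\ u != 0, a != 0, a *m u = 0 & full_root H u a].
Proof.
move=> oddq lH.
have fromJ g u a : u != 0 -> a != 0 -> a *m u = 0 -> full_root (H :^ g)%G u a ->
    exists u a, [/\ u != 0, a != 0, a *m u = 0 & full_root H u a].
  move=> u0 a0 au fg; exists (mx3 g *m u), (a *m mx3 g^-1%g); split.
  - by apply: contra u0 => /eqP E; rewrite -[u]mul1mx -(mx3V g) -mulmxA E mulmx0.
  - by apply: contra a0 => /eqP E; rewrite -[a]mulmx1 -(mx3V g) mulmxA E mul0mx.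
  - by rewrite mulmxA -[a *m _ *m _]mulmxA mx3V mulmx1.
  exact: full_rootJ.
have d0 : delta_mx o0 0 != 0 :> 'cV[F]_3.
  by apply/eqP=> /matrixP/(_ o0 0)/eqP; rewrite !mxE oner_eq0.
have d2 : delta_mx 0 o2 != 0 :> 'rV[F]_3.
  by apply/eqP=> /matrixP/(_ 0 o2)/eqP; rewrite !mxE oner_eq0.
have d20 : delta_mx 0 o2 *m delta_mx o0 0 = 0 :> 'M[F]_1 by rewrite mul_delta_mx_0.
have from02 g : (forall t, root02 t \in (H :^ g)%G) ->
    exists u a, [/\ u != 0, a != 0, a *m u = 0 & full_root H u a].
  by move=> /full_root_delta; apply: fromJ.
have [/existsP[g eg]|/existsPn many] :=
  boolP [exists g : gT, (#|(H :^ g)%G :&: elations F| <= q)%N]; last first.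
  apply: (from02 1%g); apply: full_root_many_elations => g.
  rewrite (_ : ((H :^ 1)%G :^ g)%G = (H :^ g)%G); first by rewrite ltnNge many.
  by apply: val_inj; rewrite /= conjsg1.
have lHg := large_subgroupJ g lH.
have [e1|] := leqP #|(H :^ g)%G :&: elations F| 1.
  have [s sH] := full_root_no_elations oddq lHg e1.
  apply: (fromJ g (delta_mx o0 0) (delta_mx 0 o1 + s *: delta_mx 0 o2)) => //.
  - by apply/eqP=> /matrixP/(_ 0 o1)/eqP; rewrite !mxE /= mulr0 addr0 oner_eq0.
  - by rewrite mulmxDl -scalemxAl !mul_delta_mx_0 // scaler0 addr0.
  move=> t; have [x xH Ex] := sH t; exists x => //.
  rewrite Ex mulmxDr -scalemxAr !mul_delta_mx.
  by apply/matrixP; do 2 apply: ord3_ind; rewrite !mxE /=; ring.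
move=> e1; have [x xA x1] : exists2 x, x \in (H :^ g)%G :&: elations F & x != 1%g.
  move: e1; rewrite (cardsD1 1%g) => e1.
  have /card_gt0P[x /setD1P[x1 xA]] : (0 < #|((H :^ g)%G :&: elations F) :\ 1%g|)%N.
    by apply: contraLR e1; rewrite -eqn0Ngt => /eqP->; rewrite addn0 -leqNgt leq_b1.
  by exists x.
have [xH xE] := setIP xA; have [k kS Ek] := elations_conj_root02 xE x1.
apply: (from02 (g * k)%g); rewrite (_ : (H :^ (g * k))%G = ((H :^ g)%G :^ k)%G).
  apply: full_root_few_elations => //; first exact: large_subgroupJ.
    by rewrite card_conj_elations.
  by rewrite -Ek memJ_conjg.
by apply: val_inj; rewrite /= conjsgM.
Qed.
End FullRoots.

(** * Irreducible subgroups with a full root subgroup *)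

Section DualPairs.
Local Open Scope ring_scope.
Variable F : finFieldType.
Local Notation q := #|F|.
Local Notation gT := (GL3 F).
Implicit Types (x y z g h : gT) (H : {group gT}).

Implicit Types (u v : 'cV[F]_3) (a b : 'rV[F]_3).

Lemma mx11_eq0 (A : 'M[F]_1) : (A == 0) = (A 0 0 == 0).
Proof.
apply/eqP/eqP=> [->|A0]; first by rewrite mxE.
by rewrite [A]mx11_scalar A0 raddf0.
Qed.

Lemma full_root_scale H u a c d : full_root H u a -> full_root H (c *: u) (d *: a).
Proof.
move=> fH t; have [x xH Ex] := fH (t * c * d); exists x => //.
by rewrite Ex -scalemxAl -scalemxAr !scalerA; congr (_ + _ *: _); ring.
Qed.

Lemma full_rootDr H u a b : a *m u = 0 -> full_root H u a -> full_root H u b ->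
  full_root H u (a + b).
Proof.
move=> au fa fb t; have [x xH Ex] := fa t; have [y yH Ey] := fb t.
exists (x * y)%g; first exact: groupM.
rewrite mx3M Ex Ey mulmxDl mul1mx !mulmxDr mulmx1 -!scalemxAl -!scalemxAr.
by rewrite mulmxA -[u *m a *m u]mulmxA au mulmx0 mul0mx !scaler0 addr0 scalerDr addrAC addrA.
Qed.

Lemma full_rootDl H u v a : a *m v = 0 -> full_root H u a -> full_root H v a ->
  full_root H (u + v) a.
Proof.
move=> av fu fv t; have [x xH Ex] := fu t; have [y yH Ey] := fv t.
exists (x * y)%g; first exact: groupM.
rewrite mx3M Ex Ey mulmxDl mul1mx !mulmxDl !mulmxDr mulmx1 -!scalemxAl -!scalemxAr.
by rewrite mulmxA -[u *m a *m v]mulmxA av mulmx0 mul0mx !scaler0 addr0 scalerDr addrAC addrA.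
Qed.

(* The commutator of 1 + u a and 1 + v b is 1 + (a v) u b when b u = 0. *)
Lemma full_root_comm H u a v b : a *m u = 0 -> b *m v = 0 -> b *m u = 0 ->
  a *m v != 0 -> full_root H u a -> full_root H v b -> full_root H u b.
Proof.
move=> au bv bu av fu fv t.
have c0 : (a *m v) 0 0 != 0 by rewrite -mx11_eq0.
set c := (a *m v) 0 0 in c0; have avE : a *m v = c%:M by rewrite [LHS]mx11_scalar.
have [x xH Ex] := fu (t / c); have [x' x'H Ex'] := fu (- (t / c)).
have [y yH Ey] := fv 1; have [y' y'H Ey'] := fv (- 1).
exists (x * y * x' * y')%g; first by rewrite !groupM.
rewrite !mx3M Ex Ex' Ey Ey'.
set N := t / c *: (u *m a); set M := v *m b.
rewrite !scaleNr !scale1r -/N -/M.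
have NN : N *m N = 0.
  by rewrite /N -scalemxAl -scalemxAr mulmxA -[u *m a *m u]mulmxA au mulmx0 mul0mx !scaler0.
have MM : M *m M = 0.
  by rewrite /M mulmxA -[v *m b *m v]mulmxA bv mulmx0 mul0mx.
have MN : M *m N = 0.
  by rewrite /N -scalemxAr mulmxA -[v *m b *m u]mulmxA bu mulmx0 mul0mx scaler0.
have -> : t *: (u *m b) = N *m M.
  rewrite /N /M -scalemxAl mulmxA -[u *m a *m v]mulmxA avE mul_mx_scalar -scalemxAl.
  by rewrite scalerA divfK.
have -> : (1%:M + N) *m (1%:M + M) = 1%:M + N + M + N *m M.
  by rewrite mulmxDl mul1mx mulmxDr mulmx1 addrA [_ + M + N]addrAC.
have -> : (1%:M + N + M + N *m M) *m (1%:M - N) = 1%:M + M + N *m M.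
  rewrite mulmxBr mulmx1 !mulmxDl mul1mx NN MN -mulmxA MN mulmx0 !addr0.
  by rewrite addrAC [_ + M - N]addrAC addrK.
rewrite mulmxBr mulmx1 !mulmxDl mul1mx MM -mulmxA MM mulmx0 !addr0.
by rewrite addrAC addrK.
Qed.

Lemma row_pair_spans u a b c : u != 0 -> a != 0 -> (forall k, b != k *: a) ->
  a *m u = 0 -> b *m u = 0 -> c *m u = 0 -> exists k l, c = k *: a + l *: b.
Proof.
move=> u0 a0 ba au bu cu.
have sub : (a + b <= kermx u)%MS by rewrite addsmx_sub !sub_kermx au bu eqxx.
have lt : (a < a + b)%MS.
  rewrite ltmxE addsmxSl; apply/negP=> /(submx_trans (addsmxSr a b)).
  by case/sub_rVP=> k bk; have := ba k; rewrite bk eqxx.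
have ra : \rank a = 1%N by rewrite rank_rV a0.
have ru : \rank u = 1%N by rewrite -mxrank_tr rank_rV trmx_eq0 u0.
have rk : \rank (kermx u) = 2 by rewrite mxrank_ker ru.
have : (c <= a + b)%MS.
  apply: submx_trans (_ : c <= kermx u)%MS _; first by rewrite sub_kermx cu.
  rewrite -(geq_leqif (mxrank_leqif_sup sub)) rk.
  by have := rank_ltmx lt; rewrite ra.
case/sub_addsmxP=> -[k l] /= ->; exists (k 0 0), (l 0 0).
by rewrite [k]mx11_scalar [l]mx11_scalar !mul_scalar_mx !mxE !mulr1n.
Qed.

Lemma col_pair_spans a u v w : a != 0 -> u != 0 -> (forall k, v != k *: u) ->
  a *m u = 0 -> a *m v = 0 -> a *m w = 0 -> exists k l, w = k *: u + l *: v.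
Proof.
move=> a0 u0 vu au av aw.
have tr (x : 'cV[F]_3) : a *m x = 0 -> x^T *m a^T = 0.
  by move=> E; rewrite -trmx_mul E trmx0.
have vuT k : v^T != k *: u^T.
  by apply: contra (vu k) => /eqP E; rewrite -[v]trmxK E linearZ /= trmxK.
have aT0 : a^T != 0 by rewrite trmx_eq0.
have uT0 : u^T != 0 by rewrite trmx_eq0.
have [k [l E]] := row_pair_spans aT0 uT0 vuT (tr _ au) (tr _ av) (tr _ aw).
by exists k, l; rewrite -[w]trmxK E linearD !linearZ /= !trmxK.
Qed.

Lemma row_dual u : u != 0 -> exists a : 'rV[F]_3, a *m u = 1%:M.
Proof.
move=> u0; have [i ui] : exists i, u i 0 != 0.
  apply/existsP; apply: contraR u0 => /existsPn E; apply/eqP/matrixP=> i j.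
  by rewrite ord1 mxE; apply/eqP/negPn/E.
exists ((u i 0)^-1 *: delta_mx 0 i); rewrite -scalemxAl -rowE.
apply/matrixP=> k l; rewrite !ord1 !mxE; exact: mulVf.
Qed.

(** Otherwise [a] and [b] span all rows killing [u], so each of these kills [v] too. Applied to e_i
    - u_i c with c u = 1, this gives v = (c v) u, a contradiction. *)
Lemma row_killing_pair u v a b : u != 0 -> (forall k, v != k *: u) -> a != 0 ->
  a *m u = 0 -> a *m v = 0 -> b *m u = 0 -> b *m v = 0 -> exists k, b = k *: a.
Proof.
move=> u0 vu a0 au av bu bv.
have [/existsP[k /eqP ->]|/existsPn ba] := boolP [exists k : F, b == k *: a].
  by exists k.
have [c cu] := row_dual u0.
suff E : v = (c *m v) 0 0 *: u by have := vu ((c *m v) 0 0); rewrite -E eqxx.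
apply/matrixP=> i j; rewrite ord1.
pose d : 'rV[F]_3 := delta_mx 0 i.
have du (w : 'cV[F]_3) : d *m w = (w i 0)%:M.
  by rewrite -rowE; apply/matrixP=> k l; rewrite !ord1 !mxE mulr1n.
have : (d - (u i 0) *: c) *m u = 0.
  by rewrite mulmxBl du -scalemxAl cu scalemx1 subrr.
case/(row_pair_spans u0 a0 ba au bu) => k [l E].
have : (d - (u i 0) *: c) *m v = 0.
  by rewrite E mulmxDl -!scalemxAl av bv !scaler0 addr0.
rewrite mulmxBl du -scalemxAl => /matrixP/(_ 0 0)/eqP.
by rewrite !mxE subr_eq0 mulr1n => /eqP ->; rewrite mulrC.
Qed.

Lemma exists_killing_row u v : exists2 a : 'rV[F]_3, a != 0 & a *m u = 0 /\ a *m v = 0.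
Proof.
pose A := row_mx u v; exists (nz_row (kermx A)).
  rewrite nz_row_eq0 -mxrank_eq0 mxrank_ker subn_eq0 -ltnNge.
  by rewrite (leq_ltn_trans (rank_leq_col A)).
have /sub_kermxP := nz_row_sub (kermx A).
by rewrite mul_mx_row -row_mx0 => /eq_row_mx.
Qed.

Lemma exists_killed_col a b : exists2 u : 'cV[F]_3, u != 0 & a *m u = 0 /\ b *m u = 0.
Proof.
have [c c0 [ca cb]] := exists_killing_row a^T b^T.
exists c^T; first by rewrite trmx_eq0.
by split; apply: trmx_inj; rewrite trmx_mul trmxK trmx0.
Qed.

End DualPairs.

(** * From one root subgroup to all of SL_3 *)

Section Generation.
Local Open Scope ring_scope.
Variable F : finFieldType.
Local Notation q := #|F|.
Local Notation gT := (GL3 F).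
Implicit Types (x y z g h : gT) (H : {group gT}).

Implicit Types (u v : 'cV[F]_3) (a b : 'rV[F]_3).

Definition no_fixed_row H := forall a, a != 0 ->
  exists2 h, h \in H & forall k : F, a *m mx3 h != k *: a.

Definition no_fixed_col H := forall u, u != 0 ->
  exists2 h, h \in H & forall k : F, mx3 h *m u != k *: u.

Definition full_center H u := forall a, a *m u = 0 -> full_root H u a.

Definition full_axis H a := forall u, a *m u = 0 -> full_root H u a.

Lemma mul_mx3_col_eq0 h u : (mx3 h *m u == 0) = (u == 0).
Proof.
apply/eqP/eqP=> [E|->]; last exact: mulmx0.
by rewrite -[u]mul1mx -(mx3V h) -mulmxA E mulmx0.
Qed.

Lemma mul_mx3_row_eq0 h a : (a *m mx3 h == 0) = (a == 0).
Proof.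
apply/eqP/eqP=> [E|->]; last exact: mul0mx.
by rewrite -[a]mulmx1 -(mx3Vr h) mulmxA E mul0mx.
Qed.

Lemma mul_mx3V_col h a u : (a *m mx3 h^-1%g) *m (mx3 h *m u) = a *m u.
Proof. by rewrite mulmxA -[a *m _ *m _]mulmxA mx3V mulmx1. Qed.

(** The centre [u] lies on the axis [b]. If also a v = 0, both axes are the line uv, and the centres
    [u] and [v] together yield every centre on it. If not, a commutator yields the root subgroup of
    centre [u] and axis [b], and the axes [a] and [b] yield every axis through [u]. *)
Lemma full_center_or_axis H u v a b :
  u != 0 -> (forall k, v != k *: u) -> a != 0 -> b != 0 ->
  a *m u = 0 -> b *m v = 0 -> b *m u = 0 -> full_root H u a -> full_root H v b ->
  full_center H u \/ full_axis H b.
Proof.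
move=> u0 vu a0 b0 au bv bu fu fv.
have [av|av] := eqVneq (a *m v) 0.
  right; have [k Ea] := row_killing_pair u0 vu b0 bu bv au av.
  have k0 : k != 0 by apply: contra a0 => /eqP k0; rewrite Ea k0 scale0r.
  have fub : full_root H u b.
    rewrite -[u]scale1r (_ : b = k^-1 *: a); first exact: full_root_scale.
    by rewrite Ea scalerA mulVf // scale1r.
  move=> w bw; have [l [m ->]] := col_pair_spans b0 u0 vu bu bv bw.
  rewrite -[b]scale1r; apply: full_rootDl; first by rewrite scale1r -scalemxAr bv scaler0.
    exact: full_root_scale.
  exact: full_root_scale.
left; have fub := full_root_comm au bv bu av fu fv.
have ba k : b != k *: a.
  apply: contra b0 => /eqP E; move: bv; rewrite E -scalemxAl => /eqP.
  by rewrite scaler_eq0 (negPf av) orbF => /eqP ->; rewrite scale0r.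
move=> c cu; have [l [m ->]] := row_pair_spans u0 a0 ba au bu cu.
rewrite -[u]scale1r; apply: full_rootDr; first by rewrite scale1r -scalemxAl au scaler0.
  exact: full_root_scale.
exact: full_root_scale.
Qed.

(** Two conjugate root subgroups are sought with distinct centres, one centre lying on the other
    axis. If [u] and v = h u fail in both orders, and w = g u with axis [d] also fails with [u], the
    root subgroup of [u] contains an element moving [v] along the line uv onto the axis [d]. *)
Lemma full_center_or_axis_exists H u a : no_fixed_row H -> no_fixed_col H ->
  u != 0 -> a != 0 -> a *m u = 0 -> full_root H u a ->
  (exists2 u, u != 0 & full_center H u) \/ (exists2 a, a != 0 & full_axis H a).
Proof.
move=> irr irc u0 a0 au fu.
have pair u1 a1 v b : u1 != 0 -> a1 != 0 -> b != 0 -> (forall k, v != k *: u1) ->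
    a1 *m u1 = 0 -> b *m v = 0 -> b *m u1 = 0 -> full_root H u1 a1 -> full_root H v b ->
  (exists2 u, u != 0 & full_center H u) \/ (exists2 a, a != 0 & full_axis H a).
  move=> u10 a10 b0 vu a1u1 bv bu1 f1 fv.
  have [fc|fa] := full_center_or_axis u10 vu a10 b0 a1u1 bv bu1 f1 fv.
    by left; exists u1.
  by right; exists b.
have [h hH hu] := irc u u0.
set v := mx3 h *m u in hu; pose b := a *m mx3 h^-1%g.
have v0 : v != 0 by rewrite mul_mx3_col_eq0.
have b0 : b != 0 by rewrite mul_mx3_row_eq0.
have bv : b *m v = 0 by rewrite mul_mx3V_col.
have fv : full_root H v b := full_rootM hH fu.
have [bu|bu] := eqVneq (b *m u) 0; first exact: (pair u a v b).
have uv k : u != k *: v.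
  have [->|k0] := eqVneq k 0; first by rewrite scale0r.
  apply: contra (hu k^-1) => /eqP ->.
  by rewrite scalerA mulVf // scale1r.
have [av|av] := eqVneq (a *m v) 0; first exact: (pair v b u a).
have [c c0 [cu cv]] := exists_killing_row u v.
(* If the orbit of [u] stayed on the line [c] through [u] and [v], every c g would kill [u] and [v];
   then [H] would fix [c] up to scalars. *)
have [g gH cw] : exists2 g, g \in H & c *m (mx3 g *m u) != 0.
  apply/exists_inP; apply: contraT; rewrite negb_exists_in => /forall_inP cg0.
  have cg g : g \in H -> c *m mx3 g *m u = 0.
    by move=> gH; rewrite -mulmxA; apply/eqP/negPn/cg0.
  have [g gH cgc] := irr c c0.
  have cgv : c *m mx3 g *m v = 0.
    by rewrite /v mulmxA -[c *m _ *m _]mulmxA -mx3M cg ?groupM.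
  have [k E] := row_killing_pair u0 hu c0 cu cv (cg _ gH) cgv.
  by have := cgc k; rewrite E eqxx.
set w := mx3 g *m u in cw; pose d := a *m mx3 g^-1%g.
have d0 : d != 0 by rewrite mul_mx3_row_eq0.
have dw : d *m w = 0 by rewrite mul_mx3V_col.
have fw : full_root H w d := full_rootM gH fu.
have [du|du] := eqVneq (d *m u) 0.
  apply: (pair u a w d) => // k; apply: contra cw => /eqP ->.
  by rewrite -scalemxAr cu scaler0.
have sc (x : 'rV[F]_3) (y : 'cV[F]_3) : x *m y = ((x *m y) 0 0)%:M by rewrite {1}[x *m y]mx11_scalar.
pose du' := (d *m u) 0 0; pose dv' := (d *m v) 0 0; pose av' := (a *m v) 0 0.
have du0 : du' != 0 by rewrite /du' -mx11_eq0.
have av0 : av' != 0 by rewrite /av' -mx11_eq0.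
(* [r] spans the intersection of the line [uv] with the axis of [d]. *)
have [x xH Ex] := fu (- (dv' / du' / av')).
pose r := mx3 x *m v.
have rE : r = v - (dv' / du') *: u.
  rewrite /r Ex mulmxDl mul1mx -scalemxAl -mulmxA (sc a v) -/av' mul_mx_scalar scalerA.
  by rewrite mulNr divfK // scaleNr.
have dr : d *m r = 0.
  rewrite rE mulmxBr -scalemxAr (sc d v) (sc d u) -/du' -/dv' scale_scalar_mx divfK //.
  by rewrite subrr.
have r0 : r != 0 by rewrite mul_mx3_col_eq0.
apply: (pair r (b *m mx3 x^-1%g) w d) => //.
- by rewrite mul_mx3_row_eq0.
- move=> k; apply: contra cw => /eqP ->.
  by rewrite rE -scalemxAr mulmxBr -scalemxAr cu cv scaler0 subrr scaler0.
- by rewrite mul_mx3V_col.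
exact: full_rootM.
Qed.

(** In the full-axis case two conjugate axes meet in a point [m]. Each contributes the root subgroup
    of centre [m] with that axis, and the two axes span all axes through [m]. *)
Lemma exists_full_center H u a : no_fixed_row H -> no_fixed_col H ->
  u != 0 -> a != 0 -> a *m u = 0 -> full_root H u a ->
  exists2 u, u != 0 & full_center H u.
Proof.
move=> irr irc u0 a0 au fu.
have [//|[a' a'0 fa]] := full_center_or_axis_exists irr irc u0 a0 au fu.
have [h hH ah] := irr a' a'0.
have [m m0 [am hm]] := exists_killed_col a' (a' *m mx3 h).
exists m => // c cm; have [k [l ->]] := row_pair_spans m0 a'0 ah am hm cm.
rewrite -[m]scale1r; apply: full_rootDr; first by rewrite scale1r -scalemxAl am scaler0.
  by apply: full_root_scale; apply: fa.
apply: full_root_scale; have ahm : a' *m (mx3 h *m m) = 0 by rewrite mulmxA.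
by have := full_rootM (groupVr hH) (fa _ ahm); rewrite invgK mulmxA mx3V mul1mx.
Qed.

(** Gaussian elimination by row operations, each a multiplication by an element of [H]. The cases go
    from unipotent upper triangular matrices to arbitrary ones. *)
Lemma SL_generated H :
  (forall i j : 'I_3, i != j -> full_root H (delta_mx i 0) (delta_mx 0 j)) ->
  SL F \subset H.
Proof.
move=> el.
have red (i j : 'I_3) (t : F) x : i != j -> x \in SL F ->
    (forall y, y \in SL F ->
      (forall k l, mx3 y k l = mx3 x k l + (if k == i then t * mx3 x j l else 0)) -> y \in H) ->
    x \in H.
  move=> ij xS; have [z zH Ez] := el i j ij t; move=> yH.
  have zS : z \in SL F.
    apply/SL3P; rewrite Ez mul_delta_mx det3E.
    by move: i j ij {el Ez yH}; do 2 apply: ord3_ind; rewrite // !mxE /= => _; ring.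
  rewrite -(groupMl x zH); apply: yH; first exact: groupM.
  move=> k l; rewrite mx3M Ez mul_delta_mx mulmxDl mul1mx -scalemxAl [LHS]mxE.
  congr (_ + _); rewrite mxE mxE (bigD1 j) //= !mxE eqxx andbT.
  rewrite big1 ?addr0 => [|m mj]; last by rewrite mxE (negPf mj) andbF mul0r.
  by case: (k == i); rewrite ?mul1r // mul0r mulr0.
have n01 : o0 != o1 by []. have n02 : o0 != o2 by []. have n10 : o1 != o0 by [].
have n12 : o1 != o2 by []. have n20 : o2 != o0 by []. have n21 : o2 != o1 by [].
have z0 (c d : F) : d = 0 -> c * d = 0 by move=> ->; rewrite mulr0.
have unit x : x \in SL F -> mx3 x o0 o0 = 1 -> mx3 x o1 o1 = 1 -> mx3 x o2 o2 = 1 ->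
    mx3 x o1 o0 = 0 -> mx3 x o2 o0 = 0 -> mx3 x o2 o1 = 0 -> x \in H.
  move=> xS x00 x11 x22 x10 x20 x21.
  apply: (red o1 o2 (- mx3 x o1 o2)) => // y yS Ey.
  apply: (red o0 o2 (- mx3 y o0 o2)) => // z zS Ez.
  apply: (red o0 o1 (- mx3 z o0 o1)) => // w wS Ew.
  suff -> : w = 1%g by apply: group1.
  apply: mx3_eq; do 2 apply: ord3_ind; rewrite mx3_1E Ew !Ez !Ey /=;
    rewrite ?x00 ?x11 ?x22 ?x10 ?x20 ?x21; ring.
have upper x : x \in SL F -> mx3 x o0 o0 = 1 -> mx3 x o1 o0 = 0 -> mx3 x o2 o0 = 0 ->
    mx3 x o1 o1 = 1 -> x \in H.
  move=> xS x00 x10 x20 x11.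
  apply: (red o2 o1 (- mx3 x o2 o1)) => // y yS Ey.
  have y00 : mx3 y o0 o0 = 1 by rewrite Ey addr0.
  have y11 : mx3 y o1 o1 = 1 by rewrite Ey addr0.
  have y10 : mx3 y o1 o0 = 0 by rewrite Ey addr0.
  have y20 : mx3 y o2 o0 = 0 by rewrite Ey /= x20 x10 mulr0 addr0.
  have y21 : mx3 y o2 o1 = 0 by rewrite Ey /= x11 mulr1 subrr.
  apply: unit => //; move/SL3P: yS; rewrite det3E y00 y11 y10 y20 y21 => <-; ring.
have block x : x \in SL F -> mx3 x o0 o0 = 1 -> mx3 x o1 o0 = 0 -> mx3 x o2 o0 = 0 ->
    mx3 x o2 o1 != 0 -> x \in H.
  move=> xS x00 x10 x20 x21.
  apply: (red o1 o2 ((1 - mx3 x o1 o1) / mx3 x o2 o1)) => // y yS Ey.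
  apply: upper => //; rewrite Ey /= ?addr0 //.
    by rewrite x20 x10 mulr0 addr0.
  by rewrite divfK // addrC subrK.
have first1 x : x \in SL F -> mx3 x o0 o0 = 1 -> x \in H.
  move=> xS x00.
  apply: (red o1 o0 (- mx3 x o1 o0)) => // y yS Ey.
  apply: (red o2 o0 (- mx3 y o2 o0)) => // z zS Ez.
  have z00 : mx3 z o0 o0 = 1 by rewrite Ez Ey !addr0.
  have z10 : mx3 z o1 o0 = 0 by rewrite Ez Ey addr0 /= x00 mulr1 subrr.
  have z20 : mx3 z o2 o0 = 0 by rewrite Ez /= [mx3 y o0 o0]Ey addr0 x00 mulr1 subrr.
  (* When this entry vanishes, determinant 1 makes the entry (1, 1) nonzero, and adding row 1 to row
     2 leads to [block]. *)
  have [z21|] := eqVneq (mx3 z o2 o1) 0; last exact: block.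
  have z11 : mx3 z o1 o1 != 0.
    apply: contraTneq zS => z11; apply/SL3P; rewrite det3E z00 z10 z20 z21 z11 => /esym/eqP.
    by rewrite (_ : _ + _ = 0) ?oner_eq0 //; ring.
  apply: (red o2 o1 1) => // w wS Ew; apply: block => //; rewrite Ew ?addr0 //=.
    by rewrite z20 z10 mulr0 addr0.
  by rewrite z21 add0r mul1r.
have col i x : i != o0 -> x \in SL F -> mx3 x i o0 != 0 -> x \in H.
  move=> i0 xS xi; rewrite eq_sym in i0.
  apply: (red o0 i ((1 - mx3 x o0 o0) / mx3 x i o0)) => // y yS Ey.
  by apply: first1 => //; rewrite Ey eqxx divfK // addrC subrK.
apply/subsetP=> x xS.
have [x10|] := eqVneq (mx3 x o1 o0) 0; last exact: col.
have [x20|] := eqVneq (mx3 x o2 o0) 0; last exact: col.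
have x00 : mx3 x o0 o0 != 0.
  apply: contraTneq xS => x00; apply/SL3P; rewrite det3E x00 x10 x20 => /esym/eqP.
  by rewrite (_ : _ + _ = 0) ?oner_eq0 //; ring.
apply: (red o1 o0 1) => // y yS Ey; apply: (col o1) => //.
by rewrite Ey /= x10 add0r mul1r.
Qed.

(** Irreducibility gives three independent full centres u, h u, g u. In the basis [B] they form, all
    elementary root subgroups lie in the conjugate of [H]. *)
Lemma irreducible_full_root H u a : no_fixed_row H -> no_fixed_col H ->
  u != 0 -> a != 0 -> a *m u = 0 -> full_root H u a -> SL F \subset H.
Proof.
move=> irr irc u0' a0' au' fu'.
have {u0' a0' au' fu' u a} [u u0 fu] := exists_full_center irr irc u0' a0' au' fu'.
have fcM h : h \in H -> full_center H (mx3 h *m u).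
  move=> hH a ahu; rewrite -[a]mulmx1 -(mx3Vr h) mulmxA.
  by apply: full_rootM => //; apply: fu; rewrite -mulmxA.
have [h hH hu] := irc u u0.
have [c c0 [cu cv]] := exists_killing_row u (mx3 h *m u).
have [g gH cw] : exists2 g, g \in H & c *m (mx3 g *m u) != 0.
  apply/exists_inP; apply: contraT; rewrite negb_exists_in => /forall_inP cg0.
  have cg g : g \in H -> c *m mx3 g *m u = 0.
    by move=> gH; rewrite -mulmxA; apply/eqP/negPn/cg0.
  have [g gH cgc] := irr c c0.
  have cgv : c *m mx3 g *m (mx3 h *m u) = 0.
    by rewrite mulmxA -[c *m _ *m _]mulmxA -mx3M cg ?groupM.
  have [k E] := row_killing_pair u0 hu c0 cu cv (cg _ gH) cgv.
  by have := cgc k; rewrite E eqxx.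
pose f (i : 'I_3) : gT := nth 1%g [:: 1%g; h; g] i.
have fH i : f i \in H by move: i; apply: ord3_ind; rewrite //= group1.
pose B : 'M[F]_3 := \matrix_(k, i) (mx3 (f i) *m u) k 0.
have BE i : B *m delta_mx i 0 = mx3 (f i) *m u.
  by rewrite -colE; apply/matrixP=> k l; rewrite !ord1 !mxE.
have dB : \det B != 0.
  rewrite -unitfE -unitmxE -row_free_unit -kermx_eq0; apply/eqP/row_matrixP=> i.
  rewrite row0; have : row i (kermx B) *m B = 0 by apply/sub_kermxP/row_sub.
  move: (row i _) => r rB.
  have rf j : r *m (mx3 (f j) *m u) = 0 by rewrite -BE mulmxA rB mul0mx.
  have := rf o0; rewrite /= mx3_1 mul1mx => ru.
  have [k E] := row_killing_pair u0 hu c0 cu cv ru (rf o1).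
  have := rf o2; rewrite E -scalemxAl => /eqP.
  by rewrite scaler_eq0 (negPf cw) orbF => /eqP ->; rewrite scale0r.
pose b := toGL B; have bE : mx3 b = B := toGLE dB.
have fHb : SL F \subset (H :^ b)%G.
  apply: SL_generated => i j ij t.
  have [x xH Ex] : exists2 x, x \in H
      & mx3 x = 1%:M + t *: ((mx3 (f i) *m u) *m (delta_mx 0 j *m mx3 b^-1%g)).
    apply: fcM => //; rewrite -BE -bE mul_mx3V_col mul_delta_mx_0 //.
    by rewrite eq_sym.
  exists (x ^ b)%g; first by rewrite memJ_conjg.
  rewrite conjgE mulgA !mx3M Ex -BE -bE !(mulmxDl, mulmxDr) mulmx1 mx3V.
  rewrite -!(scalemxAl, scalemxAr); congr (_ + _ *: _).
  by rewrite !mulmxA mx3V mul1mx -!mulmxA mx3V mulmx1.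
apply/subsetP=> x xS; rewrite -(memJ_conjg H b x).
by apply: (subsetP fHb); rewrite SL_J.
Qed.
End Generation.

(** * The index bound *)

Section ParabolicBound.
Local Open Scope ring_scope.
Variable F : finFieldType.
Local Notation q := #|F|.
Local Notation gT := (GL3 F).
Implicit Types (x y z g h : gT) (H : {group gT}).

Implicit Types (u v : 'cV[F]_3) (a b : 'rV[F]_3).

(** With |N| >= d q^2 and H ∩ N inside the elations, |H| |N| = |HN| |H ∩ N| <= |P| q^2. *)
Lemma scalar_free_parabolic H : odd q -> scalar_free H -> H \subset PB F ->
  ((q - 1)`_3 * #|H| <= #|PB F|)%N.
Proof.
move=> oddq sfH sHP.
have [A sylA] := Sylow_exists 3 [set: {unit F}]%G.
have cA : #|A| = ((q - 1)`_3)%N by rewrite (card_Hall sylA) card_finField_unit subn1.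
pose N := [set x in PB F | [&& mx3 x o0 o1 == 0, mx3 x o1 o0 == 0, mx3 x o1 o1 == mx3 x o0 o0
  & [exists s in A, val s == mx3 x o0 o0]]].
have NP x : reflect [/\ x \in PB F, mx3 x o0 o1 = 0, mx3 x o1 o0 = 0, mx3 x o1 o1 = mx3 x o0 o0
    & exists2 s, s \in A & val s = mx3 x o0 o0] (x \in N).
  apply: (iffP setIdP) => [[xP /and4P[/eqP-> /eqP-> /eqP-> /exists_inP[s sA /eqP E]]]|].
    by split=> //; exists s.
  case=> xP -> -> -> [s sA E]; split=> //; rewrite !eqxx /=.
  by apply/exists_inP; exists s => //; apply/eqP.
have gN : group_set N.
  apply/group_setP; split.
    by apply/NP; rewrite group1 !mx3_1E; split=> //; exists 1%g => //; apply: group1.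
  move=> x y /NP[xP x01 x10 x11 [s sA Es]] /NP[yP y01 y10 y11 [t tA Et]].
  have [_ x20 x21] := parabolicP _ xP; have [_ y20 y21] := parabolicP _ yP.
  apply/NP; rewrite groupM // !mx3ME x01 x10 x11 y01 y10 y11 y20 y21.
  split; rewrite ?(mulr0, mul0r, addr0, add0r) //.
  by exists (s * t)%g; rewrite ?groupM // -Es -Et.
have cN : (#|A| * q ^ 2 <= #|N|)%N.
  pose f (sv : {unit F} * (F * F)) :=
    let s := FinRing.uval sv.1 in toGL (m33 s 0 sv.2.1 0 s sv.2.2 0 0 (s ^- 2)).
  have fE s (v : F * F) : mx3 (f (s, v)) = m33 (val s) 0 v.1 0 (val s) v.2 0 0 (val s ^- 2).
    have s0 : val s != 0 by rewrite -unitfE; apply: (valP s).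
    rewrite toGL_m33 // (_ : _ + _ = 1) ?oner_neq0 //; by field.
  have injf : injective f.
    move=> [s [v v']] [t [w w']] /(congr1 (@mx3 F)); rewrite !fE => /matrixP E.
    have := E o0 o0; have := E o0 o2; have := E o1 o2; rewrite !mxE /= => -> -> Est.
    by congr (_, _); apply: val_inj.
  rewrite -mulnn -card_prod -[#|{: F * F}|]cardsT -cardsX -(card_imset _ injf).
  apply: subset_leq_card; apply/subsetP=> _ /imsetP[[s v] /setXP[/= sA _] ->].
  have s0 : val s != 0 by rewrite -unitfE; apply: (valP s).
  apply/NP; rewrite !fE !mxE /=; split=> //; last by exists s.
  apply/parabolicP; rewrite !fE !mxE /=; split=> //; apply/SL3P.
  by rewrite fE m33_det; field.
pose NG := Group gN.
have sNP : NG \subset PB F by apply/subsetP=> x /NP[].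
(* A nontrivial 3-element of [N] has a power whose unipotent part can be removed, leaving a
   nontrivial scalar of order 3. *)
have sLN : H :&: NG \subset elations F.
  apply/subsetP=> x /setIP[xH xN]; have [xP x01 x10 x11 [s sA Es]] := NP _ xN.
  have xkN k : (x ^+ k)%g \in N by apply: (groupX k (xN : x \in NG)).
  have xk k : mx3 (x ^+ k)%g o0 o0 = val (s ^+ k)%g.
    elim: k => [|k IHk]; first by rewrite !expg0 mx3_1E.
    have [/parabolicP[_ xk20 _] _ _ _ _] := NP _ (xkN k).
    by rewrite !expgS mx3ME x01 xk20 IHk -Es mul0r mulr0 !addr0.
  have s1 : s = 1%g.
    apply/eqP; rewrite -order_eq1.
    have [[|j] sj] := p_natP (mem_p_elt (pHall_pgroup sylA) sA); first by rewrite sj.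
    suff : (s ^+ (3 ^ j) == 1)%g by rewrite -order_dvdn sj dvdn_Pexp2l // ltnn.
    have [yP y01 y10 y11 _] := NP _ (xkN (3 ^ j)%N).
    have := parabolic_det yP; have [_ y20 y21] := parabolicP _ yP.
    rewrite y01 y10 y11; set w := mx3 _ o0 o0 in y11 * => dy.
    have w3 : w * w * w = 1.
      rewrite /w xk -[_ * _]/(val (s ^+ (3 ^ j) * s ^+ (3 ^ j) * s ^+ (3 ^ j))%g).
      by rewrite -!expgD (_ : _ + _ + _ = #[s]%g)%N ?expg_order //
        sj expnS !mulSn mul0n addn0 addnA.
    have w0 : w != 0 by apply: contra_eq_neq w3 => ->; rewrite mulr0 eq_sym oner_neq0.
    have y22 : mx3 (x ^+ (3 ^ j))%g o2 o2 = w.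
      by apply: (mulfI (mulf_neq0 w0 w0)); rewrite w3 -dy; ring.
    have w1 : w = 1.
      by apply: (unipotent_scalar oddq sfH (groupX (3 ^ j) xH)).
    by apply/eqP/val_inj; rewrite /= -xk -/w w1.
  have x00 : mx3 x o0 o0 = 1 by rewrite -Es s1.
  have [_ x20 x21] := parabolicP _ xP.
  apply/elationsP; rewrite x11 x00 x01 x10 x20 x21; split=> //; split=> //.
  by have := parabolic_det xP; rewrite x11 x00 x01 => <-; ring.
have q0 : (0 < q ^ 2)%N by rewrite expn_gt0 (ltnW (card_finNzRing_gt1 F)).
rewrite -(leq_pmul2r q0) -cA.
apply: (@leq_trans (#|H| * #|NG|)); first by rewrite mulnAC mulnC leq_mul2l cN orbT.
rewrite mul_cardG leq_mul //; first by apply: subset_leq_card; apply: mul_subG.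
by apply: leq_trans (subset_leq_card sLN) (card_elations_le F).
Qed.
End ParabolicBound.

Section IndexBound.
Local Open Scope ring_scope.
Variable F : finFieldType.
Local Notation q := #|F|.
Local Notation gT := (GL3 F).
Implicit Types (x y z g h : gT) (H : {group gT}).

Implicit Types (u v : 'cV[F]_3) (a b : 'rV[F]_3).

(** An invertible matrix with last row [a] maps the last unit row to [a]; its inverse is the
    required element. *)
Lemma row_to_last a : a != 0 -> exists g, a *m mx3 g = delta_mx 0 o2.
Proof.
have inv g : delta_mx 0 o2 *m mx3 g = a -> exists g, a *m mx3 g = delta_mx 0 o2.
  by move=> <-; exists g^-1%g; rewrite -mulmxA mx3Vr mulmx1.
have last3 (b c d e f g : F) : b * (f * a 0 o2 - g * a 0 o1) - c * (e * a 0 o2 - g * a 0 o0)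
    + d * (e * a 0 o1 - f * a 0 o0) != 0 -> exists g, a *m mx3 g = delta_mx 0 o2.
  move=> D; apply: (inv (toGL (m33 b c d e f g (a 0 o0) (a 0 o1) (a 0 o2)))).
  rewrite toGL_m33 // -rowE; apply/matrixP=> i; rewrite ord1.
  by apply: ord3_ind; rewrite !mxE.
move=> a0.
have [a00|] := eqVneq (a 0 o0) 0; last first.
  move=> n0; apply: (last3 0 1 0 0 0 1); rewrite (_ : _ + _ = a 0 o0) //; ring.
have [a01|] := eqVneq (a 0 o1) 0; last first.
  move=> n0; apply: (last3 0 0 1 1 0 0); rewrite (_ : _ + _ = a 0 o1) //; ring.
apply: (last3 1 0 0 0 1 0); rewrite (_ : _ + _ = a 0 o2); last by ring.
apply: contra a0 => /eqP a02; apply/eqP/matrixP=> i; rewrite ord1.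
by apply: ord3_ind; rewrite mxE.
Qed.

Lemma scalar_free_fixed_row H a : odd q -> scalar_free H -> H \subset SL F ->
  a != 0 -> (forall h, h \in H -> exists k, a *m mx3 h = k *: a) ->
  ((q - 1)`_3 * #|H| <= #|PB F|)%N.
Proof.
move=> oddq sfH sHS /row_to_last[g ag] fixa.
rewrite -(cardJg H g); apply: (@scalar_free_parabolic _ (H :^ g)%G) => //.
  exact: scalar_freeJ.
apply/subsetP=> _ /imsetP[h hH ->].
have [k ah] := fixa h hH.
have E : a *m mx3 g *m mx3 (h ^ g)%g = k *: (a *m mx3 g).
  by rewrite conjgE !mx3M !mulmxA -[a *m _ *m _]mulmxA mx3Vr mulmx1 ah -scalemxAl.
rewrite ag -rowE in E; apply/parabolicP; split.
- by rewrite SL_J (subsetP sHS).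
- by have /matrixP/(_ 0 o0) := E; rewrite !mxE mulr0.
by have /matrixP/(_ 0 o1) := E; rewrite !mxE mulr0.
Qed.

(** The inverse transpose exchanges points and lines, reducing a fixed column to a fixed row. *)
Definition contragredient x : gT := toGL (mx3 x^-1%g)^T.

Lemma contragredientE x : mx3 (contragredient x) = (mx3 x^-1%g)^T.
Proof. by rewrite toGLE // det_tr det_mx3. Qed.

Lemma contragredientM x y : contragredient (x * y)%g = (contragredient x * contragredient y)%g.
Proof. by apply: mx3_inj; rewrite mx3M !contragredientE invMg mx3M trmx_mul. Qed.

Lemma contragredient_inj : injective contragredient.
Proof.
move=> x y /(congr1 (@mx3 F)); rewrite !contragredientE => /trmx_inj/mx3_inj.
exact: invg_inj.
Qed.

Lemma scalar_free_fixed_col H u : odd q -> scalar_free H -> H \subset SL F ->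
  u != 0 -> (forall h, h \in H -> exists k, mx3 h *m u = k *: u) ->
  ((q - 1)`_3 * #|H| <= #|PB F|)%N.
Proof.
move=> oddq sfH sHS u0 fixu.
have gC : group_set [set contragredient x | x in H].
  apply/group_setP; split.
    apply/imsetP; exists 1%g => //; apply: mx3_inj.
    by rewrite contragredientE invg1 mx3_1 trmx1.
  move=> _ _ /imsetP[x xH ->] /imsetP[y yH ->].
  by rewrite -contragredientM imset_f ?groupM.
rewrite -(card_imset _ contragredient_inj).
apply: (@scalar_free_fixed_row (Group gC) u^T) => //.
- move=> _ c /imsetP[x xH ->]; rewrite contragredientE => /(congr1 trmx).
  by rewrite trmxK tr_scalar_mx; apply: sfH; rewrite groupV.
- apply/subsetP=> _ /imsetP[x xH ->]; apply/SL3P; rewrite contragredientE det_tr.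
  by apply/SL3P; rewrite groupV (subsetP sHS).
- by rewrite trmx_eq0.
move=> _ /imsetP[x xH ->]; have [|k E] := fixu x^-1%g; first by rewrite groupV.
by exists k; rewrite contragredientE -trmx_mul E linearZ.
Qed.

Theorem index_scalar_free H : odd q -> scalar_free H -> H \subset SL F ->
  ~~ (SL F \subset H) -> ((q - 1)`_3 * (q ^ 2 + q + 1) <= #|SL F : H|%g)%N.
Proof.
move=> oddq sfH sHS nSH; rewrite leqNgt; apply/negP=> ltn.
have q1 : (1 < q)%N := card_finNzRing_gt1 F.
set d := ((q - 1)`_3)%N in ltn *; set m := (q ^ 2 + q + 1)%N in ltn.
have H0 : (0 < #|H|)%N := cardG_gt0 H.
(* By Lagrange this is the assumed bound on the index. It contradicts the bound for subgroups fixing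
   a line or a point. *)
have dH : (#|PB F| < d * #|H|)%N.
  have m0 : (0 < m)%N by rewrite /m addn1.
  by rewrite -(ltn_pmul2r m0) -card_SL -(Lagrange sHS) mulnAC mulnC ltn_pmul2r.
(* As q - 1 is even and [d] is odd, the cofactor of [d] is even and nonzero. *)
have d2 : (2 * d <= q - 1)%N.
  have [k Ek] := dvdnP (dvdn_part 3%N (q - 1)%N).
  rewrite -/d in Ek; rewrite Ek leq_pmul2r ?part_gt0 //.
  have : ~~ odd (q - 1) by rewrite oddB ?(ltnW q1) // oddq.
  rewrite Ek oddM [in odd d]/d p_part oddX orbT andbT.
  by case: k Ek => [|[|k]] //; rewrite mul0n => /eqP; rewrite subn_eq0 leqNgt q1.
have lH : large_subgroup H.
  split=> //; rewrite -(Lagrange sHS) mulnCA mulnC ltn_pmul2r //.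
  apply: (@leq_trans (2 * (d * m))); first by rewrite ltn_pmul2l.
  rewrite mulnA (leq_trans (leq_mul d2 (leqnn m))) // /m.
  by case: (q) q1 => // n _; rewrite !expnS expn0 !subn1 /=; lia.
have [u [a [u0 a0 au fu]]] := exists_full_root oddq lH.
case/negP: nSH; apply: (irreducible_full_root _ _ u0 a0 au fu).
  move=> b b0.
  have [/exists_inP[h hH /forallP hb]|/exists_inPn fixb] :=
    boolP [exists h in H, [forall k : F, b *m mx3 h != k *: b]]; first by exists h.
  move: dH; rewrite ltnNge => /negP[]; apply: (scalar_free_fixed_row oddq sfH sHS b0) => h hH.
  by have /forallPn[k /negPn/eqP] := fixb h hH; exists k.
move=> w w0.
have [/exists_inP[h hH /forallP hw]|/exists_inPn fixw] :=
  boolP [exists h in H, [forall k : F, mx3 h *m w != k *: w]]; first by exists h.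
move: dH; rewrite ltnNge => /negP[]; apply: (scalar_free_fixed_col oddq sfH sHS w0) => h hH.
by have /forallPn[k /negPn/eqP] := fixw h hH; exists k.
Qed.
End IndexBound.

(** * Minimal degrees *)

Section Degree.
Local Open Scope group_scope.
Variable gT : finGroupType.
Implicit Types G H K : {group gT}.

Lemma rcosets_mul G H B x : x \in G -> B \in rcosets H G -> B :* x \in rcosets H G.
Proof.
move=> xG /rcosetsP[y yG ->].
by rewrite -rcosetM; apply/rcosetsP; exists (y * x); rewrite ?groupM.
Qed.

Lemma rcosets1 G H : gval H \in rcosets H G.
Proof. by apply/rcosetsP; exists 1; rewrite ?group1 ?rcoset1. Qed.

Section CosetAction.
Variables G H : {group gT}.

(** Right multiplication on cosets, transported to ordinals as [embeds_in_Sym] requires. Elements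
    outside [G] act trivially by convention. *)
Definition coset_ord_act (i : 'I_#|G : H|) (x : gT) : 'I_#|G : H| :=
  if x \in G then enum_rank_in (rcosets1 G H) (enum_val i :* x) else i.

Lemma enum_val_coset_ord_act i x : x \in G -> enum_val (coset_ord_act i x) = enum_val i :* x.
Proof.
by move=> xG; rewrite /coset_ord_act xG enum_rankK_in // rcosets_mul // enum_valP.
Qed.

Lemma coset_ord_is_action : is_action G coset_ord_act.
Proof.
split=> [x i j E|i x y xG yG].
  have [xG|xG] := boolP (x \in G); last by move: E; rewrite /coset_ord_act (negPf xG).
  apply: enum_val_inj; apply: (rcoset_inj (x := x)).
  by rewrite -!enum_val_coset_ord_act // E.
apply: enum_val_inj; rewrite !enum_val_coset_ord_act ?groupM //.
by rewrite rcosetM.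
Qed.

Definition coset_ord_action := Action coset_ord_is_action.

Lemma core_free_embeds : gcore H G = 1 -> embeds_in_Sym G #|G : H|.
Proof.
move=> coreH; apply/existsP; exists (actperm coset_ord_action @* G)%G.
apply: sub_isog => //; apply/subsetP=> x /morphpreP[xG /set1P Ex].
rewrite -coreH -astabRs_rcosets; apply/astabP=> B BH /=.
have [j <-] : exists j : 'I_#|G : H|, enum_val j = B.
  by exists (enum_rank_in (rcosets1 G H) B); rewrite enum_rankK_in.
rewrite rcosetE -enum_val_coset_ord_act //; congr enum_val.
by have /permP/(_ j) := Ex; rewrite actpermE perm1.
Qed.

End CosetAction.

(** Some point is moved by [z], so its stabilizer avoids [z]; its orbit has at least b and at most m
    points. *)
Lemma embeds_in_Sym_lower G (z : gT) b m : z \in G -> z != 1 ->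
  (forall K, K \subset G -> z \notin K -> b <= #|G : K|) ->
  embeds_in_Sym G m -> b <= m.
Proof.
move=> zG z1 bK /existsP[S /isogP[f injf _]].
have [i zi] : exists i, f z i != i.
  apply/existsP; apply: contraR z1 => /existsPn fz.
  apply/eqP; apply: (injmP injf) => //.
  by rewrite morph1; apply/permP=> i; rewrite perm1; apply/eqP/negPn.
pose to := ('P \o f)%act.
have sG : G \subset f @*^-1 setT by apply/subsetP=> x xG; rewrite !inE xG.
have := card_orbit_in to i sG; move: (max_card (orbit to G i)); rewrite card_ord => le E.
apply: leq_trans le; rewrite [X in _ <= X]E; apply: (bK 'C_G[i | to]%G); first exact: subsetIl.
by apply: contra zi => /setIP[_]; rewrite !inE sub1set inE => /andP[_].
Qed.

Lemma min_perm_degree_eq G H (z : gT) : z \in G -> z != 1 ->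
  (forall K, K \subset G -> z \notin K -> #|G : H| <= #|G : K|) ->
  gcore H G = 1 -> min_perm_degree G = #|G : H|.
Proof.
move=> zG z1 bK coreH; rewrite /min_perm_degree; case: ex_minnP => m Gm min.
apply/eqP; rewrite eqn_leq min ?core_free_embeds //.
exact: (embeds_in_Sym_lower zG z1 bK Gm).
Qed.

End Degree.

(** * Core-free subgroups of P and the minimal degree *)

Section MinimalRep.
Local Open Scope ring_scope.
Variable F : finFieldType.
Local Notation q := #|F|.
Local Notation gT := (GL3 F).
Implicit Types (x y z g h : gT) (H : {group gT}).

Local Notation d := ((q - 1)`_3)%N.
Local Notation m := (q ^ 2 + q + 1)%N.

Lemma scalar_cube x (c : F) : x \in SL F -> mx3 x = c%:M -> c ^+ 3 = 1.
Proof. by move=> /SL3P dx Ex; rewrite -dx Ex det_scalar. Qed.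

(** Conjugating by a matrix with last row (s, t, 1) shows that this row is an eigenvector of [x].
    The rows (1, 0, 1), (-1, 0, 1), (0, 1, 1) and (0, -1, 1) suffice, since 2 is invertible. *)
Lemma core_scalar x : odd q -> (forall g, g \in SL F -> (x ^ g)%g \in PB F) ->
  exists c : F, mx3 x = c%:M.
Proof.
move=> oddq core.
have xP : x \in PB F by have := core 1%g (group1 _); rewrite conjg1.
have [_ x20 x21] := parabolicP _ xP.
have row_move (s t : F) : exists y : F,
    [/\ s * mx3 x o0 o0 + t * mx3 x o1 o0 = y * s,
        s * mx3 x o0 o1 + t * mx3 x o1 o1 = y * t
      & s * mx3 x o0 o2 + t * mx3 x o1 o2 + mx3 x o2 o2 = y].
  pose k : gT := toGL (m33 1 0 0 0 1 0 s t 1).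
  have kE : mx3 k = m33 1 0 0 0 1 0 s t 1.
    by rewrite toGL_m33 // (_ : _ + _ = 1) ?oner_eq0 //; ring.
  have kS : k \in SL F by apply/SL3P; rewrite kE m33_det; ring.
  have := core k^-1%g; rewrite groupV => /(_ kS) yP.
  have Ey : (x ^ k^-1 * k = k * x)%g by rewrite conjgE invgK mulgA mulgKV.
  move: (x ^ k^-1)%g yP Ey => y yP Ey; have [_ y20 y21] := parabolicP _ yP.
  exists (mx3 y o2 o2).
  have E0 := congr1 (fun z => mx3 z o2 o0) Ey.
  have E1 := congr1 (fun z => mx3 z o2 o1) Ey.
  have E2 := congr1 (fun z => mx3 z o2 o2) Ey.
  move: E0 E1 E2; rewrite !mx3ME kE !mxE /= x20 x21 y20 y21.
  by rewrite ?(mulr0, mulr1, mul0r, mul1r, add0r, addr0) => -> -> ->.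
have t2 := two_neq0 oddq.
have [y1 [a1 b1 c1]] := row_move 1 0; have [y2 [a2 b2 c2]] := row_move (-1) 0.
have [z1 [e1 f1 g1]] := row_move 0 1; have [z2 [e2 f2 g2]] := row_move 0 (-1).
move: a1 b1 c1 a2 b2 c2 e1 f1 g1 e2 f2 g2.
rewrite !(mulr0, mulr1, mul0r, mul1r, add0r, addr0, mulN1r, mulrN1).
move=> a1 b1 c1 /oppr_inj a2 _ c2 e1 f1 g1 _ /oppr_inj f2 g2.
have x02 : mx3 x o0 o2 = 0.
  apply: (mulfI t2); rewrite mulr0.
  have -> : 0 = y1 - y2 by rewrite -a1 -a2 subrr.
  by rewrite -c1 -c2; ring.
have x12 : mx3 x o1 o2 = 0.
  apply: (mulfI t2); rewrite mulr0.
  have -> : 0 = z1 - z2 by rewrite -f1 -f2 subrr.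
  by rewrite -g1 -g2; ring.
exists (mx3 x o2 o2); apply/matrixP; do 2 apply: ord3_ind; rewrite !mxE //=.
  by rewrite a1 -c1 x02 add0r.
by rewrite f1 -g1 x12 add0r.
Qed.

Lemma gcore_trivial H : odd q -> scalar_free H -> H \subset PB F -> gcore H (SL F) = 1%g.
Proof.
move=> oddq sfH sHP; apply/trivgP/subsetP=> x xc; apply/set1P.
have xgH g : g \in SL F -> (x ^ g)%g \in H.
  move=> gS; apply: (subsetP (gcore_sub H (SL F))).
  by rewrite memJ_norm // (subsetP (gcore_norm H (SL F))).
have [c Ex] : exists c : F, mx3 x = c%:M.
  by apply: core_scalar => // g gS; apply: (subsetP sHP); apply: xgH.
have xH : x \in H by have := xgH 1%g (group1 _); rewrite conjg1.
by apply: mx3_inj; rewrite mx3_1 Ex (sfH _ _ xH Ex).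
Qed.

Lemma index_min H : odd q -> scalar_free H -> H \subset PB F ->
  (d * #|H| = #|PB F|)%N -> #|SL F : H|%g = (d * m)%N.
Proof.
move=> oddq sfH sHP cH; have sHS := subset_trans sHP (PB_sub_SL F).
apply/eqP; rewrite -(eqn_pmul2l (cardG_gt0 H)) Lagrange // card_SL -cH mulnCA mulnA.
by [].
Qed.

Lemma card_ratio : ((q ^ 3 - 1) * d %/ (q - 1) = d * m)%N.
Proof.
have q1 : (1 < q)%N := card_finNzRing_gt1 F.
rewrite (_ : (q ^ 3 - 1) * d = d * m * (q - 1))%N; first by rewrite mulnK // subn_gt0.
rewrite [LHS]mulnC -mulnA; congr (_ * _)%N.
by case: (q) q1 => // n _; rewrite !expnS expn0 !subn1 /=; lia.
Qed.

(** Serves both cases of the theorem: [z] is [root02 1] with d = 1 when gcd(q - 1, 3) = 1, and a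
    central element of order 3 otherwise. *)
Lemma minimal_rep H z : odd q -> scalar_free H -> H \subset PB F ->
  (d * #|H| = #|PB F|)%N -> z \in SL F -> z != 1%g ->
  (forall K : {group gT}, K \subset SL F -> z \notin K -> scalar_free K) ->
  [/\ gives_min_faithful_perm_rep (SL F) H,
      min_perm_degree (SL F) = #|SL F| %/ #|H|
    & #|SL F| %/ #|H| = ((q ^ 3 - 1) * d) %/ (q - 1)]%N.
Proof.
move=> oddq sfH sHP cH zS z1 sfK.
have sHS := subset_trans sHP (PB_sub_SL F).
have idx := index_min oddq sfH sHP cH.
have core := gcore_trivial oddq sfH sHP.
have md : min_perm_degree (SL F) = #|SL F : H|%g.
  apply: (min_perm_degree_eq zS z1) => // K sKS zK; rewrite idx.
  apply: index_scalar_free => //; first exact: sfK.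
  by apply: contra zK => /subsetP; apply.
by split; rewrite ?md ?divgS // idx card_ratio.
Qed.
End MinimalRep.

(** * The two cases of gcd(q - 1, 3) *)

Section LargestComplement.
Local Open Scope ring_scope.
Variable F : finFieldType.
Local Notation q := #|F|.
Local Notation gT := (GL3 F).
Implicit Types (x y z g h : gT) (H : {group gT}).

Local Notation d := ((q - 1)`_3)%N.
Implicit Types (Z K L : {group gT}).

Lemma expf_coprime_eq1 (c : F) n e : (0 < n)%N -> coprime n e -> c ^+ n = 1 -> c ^+ e = 1 -> c = 1.
Proof.
move=> n0 /eqP co cn ce; have [k l E _] := egcdnP e n0.
have : c ^+ (k * n) = c ^+ (l * e + 1) by rewrite E co.
by rewrite mulnC exprM cn expr1n exprD mulnC exprM ce expr1n mul1r expr1.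
Qed.

Lemma card_roots_of_1 n : (0 < n)%N -> (#|[set c : F | c ^+ n == 1%R]| <= n)%N.
Proof.
move=> n0; rewrite cardE; apply: max_unity_roots; rewrite ?enum_uniq //.
by apply/allP=> c; rewrite mem_enum inE unity_rootE.
Qed.

Lemma expf_card_pred (c : F) : c != 0 -> c ^+ (q - 1) = 1.
Proof.
move=> c0; apply: (mulfI c0).
by rewrite -exprS subn1 (ltn_predK (card_finNzRing_gt1 F)) expf_card mulr1.
Qed.

Lemma PB_minimal_rep : odd q -> gcdn (q - 1) 3 = 1%N ->
  [/\ gives_min_faithful_perm_rep (SL F) (PB F),
      min_perm_degree (SL F) = #|SL F| %/ #|PB F|
    & #|SL F| %/ #|PB F| = (q ^ 3 - 1) %/ (q - 1)]%N.
Proof.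
move=> oddq g1; have q1 : (1 < q)%N := card_finNzRing_gt1 F.
have co3 : coprime 3 (q - 1) by rewrite /coprime gcdnC g1.
have d1 : d = 1%N.
  by apply: part_p'nat; rewrite p'natE // -prime_coprime.
have sfK K : K \subset SL F -> scalar_free K.
  move=> sKS x c xK Ex; have c3 := scalar_cube (subsetP sKS _ xK) Ex.
  apply: (@expf_coprime_eq1 c 3 (q - 1)) => //; apply: expf_card_pred.
  by apply: contra_eq_neq c3 => ->; rewrite expr0n eq_sym oner_neq0.
have := @minimal_rep F (PB F) (root02 1) oddq (sfK _ (PB_sub_SL F)) (subxx _).
rewrite d1 mul1n muln1; apply=> //; last by move=> K sKS _; apply: sfK.
  exact: elations_SL3 (root02_elations 1).
exact: root02_neq1.
Qed.

Lemma center_scalar x : x \in 'Z(SL F)%g -> odd q -> exists c : F, mx3 x = c%:M.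
Proof.
move=> xZ oddq; have [xS xC] := setIP xZ.
have x02 : x \in 'C[root02 1]%g.
  by apply/cent1P/(centP xC)/elations_SL3/root02_elations.
apply: core_scalar => // g gS; rewrite conjgE ((centP xC) g gS) mulKg.
exact: cent_root02_1_parabolic.
Qed.

(** The field has at most three cube roots of 1, so the three scalars in [Z] exhaust them. *)
Lemma center_order3P Z : odd q -> Z \subset 'Z(SL F)%g -> #|Z| = 3%N ->
  forall x c, mx3 x = c%:M -> c ^+ 3 = 1 -> x \in Z.
Proof.
move=> oddq sZ cZ x c Ex c3.
have inj : {in Z &, injective (fun y => mx3 y o0 o0)}.
  move=> y z yZ zZ E; apply: mx3_inj.
  have [k Ek] := center_scalar (subsetP sZ _ yZ) oddq.
  have [l El] := center_scalar (subsetP sZ _ zZ) oddq.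
  by move: E; rewrite Ek El !mxE !mulr1n => ->.
have sub : [set mx3 y o0 o0 | y in Z] \subset [set c : F | c ^+ 3 == 1].
  apply/subsetP=> _ /imsetP[y yZ ->]; rewrite inE.
  have [k Ek] := center_scalar (subsetP sZ _ yZ) oddq.
  have [yS _] := setIP (subsetP sZ _ yZ).
  by rewrite Ek mxE mulr1n (scalar_cube yS Ek).
have E : [set mx3 y o0 o0 | y in Z] = [set c : F | c ^+ 3 == 1].
  by apply/eqP; rewrite eqEcard sub card_in_imset // cZ card_roots_of_1.
have : c \in [set c : F | c ^+ 3 == 1] by rewrite inE c3.
rewrite -E => /imsetP[y yZ Ey]; rewrite (_ : x = y) //; apply: mx3_inj.
have [k Ek] := center_scalar (subsetP sZ _ yZ) oddq.
by rewrite Ex Ek Ey Ek mxE mulr1n.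
Qed.

(** A copy of [G3_candidate] in terms of the sealed [PB F]; the two become convertible once the
    constants are transparent again. *)
Definition SL3_G3_candidate Z K : bool :=
  [&& K \subset PB F, K :&: Z == 1%g & ~~ coprime #|K| 3].

Lemma scalar_free_TI Z K : odd q -> Z \subset 'Z(SL F)%g -> #|Z| = 3%N ->
  K \subset SL F -> K :&: Z = 1%g -> scalar_free K.
Proof.
move=> oddq sZ cZ sKS tiK x c xK Ex.
have xZ := center_order3P oddq sZ cZ Ex (scalar_cube (subsetP sKS _ xK) Ex).
have : x \in K :&: Z by rewrite inE xK.
rewrite tiK => /set1P x1; move: Ex; rewrite x1 mx3_1 => /matrixP/(_ o0 o0).
by rewrite !mxE !mulr1n.
Qed.

Section Order3.
Hypotheses (oddq : odd q) (g3 : gcdn (q - 1) 3 = 3%N).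

Lemma dvd3 : (3 %| q - 1)%N. Proof. by rewrite -g3 dvdn_gcdl. Qed.

Lemma exists_center_order3 : exists2 Z : {group gT}, Z \subset 'Z(SL F)%g & #|Z| = 3%N.
Proof.
have [s _ os] : {s : {unit F} | s \in [set: {unit F}]%G & #[s]%g = 3%N}.
  by apply: Cauchy => //; rewrite card_finField_unit -subn1 dvd3.
have s3 : val s ^+ 3 = 1.
  by have := expg_order s; rewrite os => /(congr1 val) /= <-; rewrite FinRing.val_unitX.
pose z : gT := toGL (val s)%:M.
have zE : mx3 z = (val s)%:M by rewrite toGLE // det_scalar s3 oner_eq0.
have zS : z \in SL F by apply/SL3P; rewrite zE det_scalar s3.
exists <[z]>%G.
  rewrite cycle_subG; apply/setIP; split=> //; apply/centP=> x xS.
  by apply: mx3_inj; rewrite !mx3M zE scalar_mxC.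
apply: (nt_prime_order (p := 3)) => //.
  by apply: mx3_inj; rewrite !expgS expg0 mulg1 !mx3M zE -!scalar_mxM mx3_1 -expr2 -exprS s3.
apply/eqP=> /(congr1 (fun y => mx3 y o0 o0)); rewrite zE mx3_1 !mxE !mulr1n => s1.
have s1' : s = 1%g by apply: val_inj.
by move: os; rewrite s1' order1.
Qed.

(** The witness has last entries killed by the 3'-part [e] of q - 1. The fibres of x_22^e, a d-th
    root of 1, give |P| <= d |N|, and [scalar_free_parabolic] gives equality. Then 3 divides |N|
    because 3 d divides (q - 1)(q^2 - 1). *)
Lemma G3_existence Z : Z \subset 'Z(SL F)%g -> #|Z| = 3%N ->
  exists2 K : {group gT}, SL3_G3_candidate Z K & (d * #|K| = #|PB F|)%N.
Proof.
move=> sZ cZ; have q1 : (1 < q)%N := card_finNzRing_gt1 F.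
pose e := ((q - 1)`_3^')%N.
have Ede : (d * e = q - 1)%N by rewrite partnC // subn_gt0.
pose N := [set x in PB F | mx3 x o2 o2 ^+ e == 1].
have ent2 x y : x \in PB F -> mx3 (x * y)%g o2 o2 = mx3 x o2 o2 * mx3 y o2 o2.
  by case/parabolicP=> _ x20 x21; rewrite mx3ME x20 x21; ring.
have gN : group_set N.
  apply/group_setP; split; first by rewrite inE group1 mx3_1E expr1n eqxx.
  move=> x y /setIdP[xP /eqP xe] /setIdP[yP /eqP ye].
  by rewrite inE groupM //= ent2 // exprMn xe ye mulr1.
have d0 : (0 < d)%N by rewrite part_gt0.
have n0 x : x \in PB F -> mx3 x o2 o2 != 0.
  by move=> xP; apply: contra_eq_neq (parabolic_det xP) => ->; rewrite mulr0 eq_sym oner_neq0.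
have leN : (#|PB F| <= d * #|N|)%N.
  apply: (@leq_trans (#|N| * #|[set c : F | c ^+ d == 1%R]|)); last first.
    by rewrite mulnC leq_mul2r card_roots_of_1 ?orbT.
  apply: (@card_le_fibers _ _ _ _ _ (fun x : gT => mx3 x o2 o2 ^+ e)).
    by move=> x xP; rewrite inE -exprM mulnC Ede expf_card_pred ?n0.
  move=> x y xP yP E; have zP : (x^-1 * y)%g \in PB F by rewrite groupM ?groupV.
  rewrite inE zP; apply/eqP; apply: (mulfI (expf_neq0 e (n0 x xP))).
  by rewrite -exprMn -ent2 // mulKVg mulr1.
have sNP : Group gN \subset PB F by apply/subsetP=> x /setIdP[].
have tiN : Group gN :&: Z = 1%g.
  apply/trivgP/subsetP=> x /setIP[/setIdP[xP /eqP xe] xZ]; apply/set1P.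
  have [c Ec] := center_scalar (subsetP sZ _ xZ) oddq.
  have [xS _] := setIP (subsetP sZ _ xZ).
  apply: mx3_inj; rewrite mx3_1 Ec; congr _%:M.
  apply: (@expf_coprime_eq1 c 3 e) => //; last by rewrite -xe Ec mxE.
    by rewrite prime_coprime // -p'natE // part_pnat.
  exact: scalar_cube Ec.
have sfN := scalar_free_TI oddq sZ cZ (subset_trans sNP (PB_sub_SL F)) tiN.
have E : (d * #|Group gN| = #|PB F|)%N.
  by apply/eqP; rewrite eqn_leq leN scalar_free_parabolic.
exists (Group gN) => //; rewrite /SL3_G3_candidate sNP tiN eqxx /=.
rewrite coprime_sym prime_coprime // negbK -(dvdn_pmul2l d0) E card_PB.
rewrite -mulnA dvdn_mull // dvdn_mul ?dvdn_part //.
by rewrite -[(q ^ 2 - 1)%N]/(q ^ 2 - 1 ^ 2)%N subn_sqr dvdn_mulr ?dvd3.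
Qed.

Lemma exists_maximal_candidate : exists Z K : {group gT},
  [/\ Z \subset 'Z(SL F)%g, #|Z| = 3%N & SL3_G3_candidate Z K /\
    forall L, SL3_G3_candidate Z L -> (#|L| <= #|K|)%N].
Proof.
have [Z sZ cZ] := exists_center_order3; have [N candN _] := G3_existence sZ cZ.
case: (@arg_maxnP _ N (SL3_G3_candidate Z) (fun L => #|L|) candN) => K candK maxK.
by exists Z, K.
Qed.

Lemma G3_minimal_rep Z K : Z \subset 'Z(SL F)%g -> #|Z| = 3%N ->
  SL3_G3_candidate Z K ->
  (forall L, SL3_G3_candidate Z L -> #|L| <= #|K|)%N ->
  [/\ gives_min_faithful_perm_rep (SL F) K,
      min_perm_degree (SL F) = #|SL F| %/ #|K|
    & #|SL F| %/ #|K| = ((q ^ 3 - 1) * d) %/ (q - 1)]%N.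
Proof.
move=> sZ cZ /and3P[sKP /eqP tiK _] maxK.
have sKS := subset_trans sKP (PB_sub_SL F).
have sfK := scalar_free_TI oddq sZ cZ sKS tiK.
have [N candN EN] := G3_existence sZ cZ.
(* Maximality compares [K] with the subgroup from [G3_existence], and [scalar_free_parabolic] bounds
   it from above. *)
have EK : (d * #|K| = #|PB F|)%N.
  by apply/eqP; rewrite eqn_leq scalar_free_parabolic // -EN leq_mul2l maxK ?orbT.
have [z zZ z1] : exists2 z, z \in Z & z != 1%g.
  by apply/trivgPn; rewrite -cardG_gt1 cZ.
apply: (minimal_rep (z := z)) => //; first by case/setIP: (subsetP sZ _ zZ).
move=> L sLS zL; apply: (scalar_free_TI oddq sZ cZ sLS).
rewrite setIC; apply: prime_TIg; first by rewrite cZ.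
by apply: contra zL => /subsetP; apply.
Qed.

End Order3.
End LargestComplement.

Transparent GL3 mx3 SL PB.

Local Open Scope group_scope.

Theorem theorem2p1 (q : nat) (F : finFieldType) (card_F : #|F| = q) (odd_q : odd q) :
  (gcdn (q - 1) 3 = 1%N ->
     [/\ gives_min_faithful_perm_rep (SL3_group F) (parabolic_group F),
         min_perm_degree (SL3_group F) = #|SL3 F| %/ #|parabolic F|
       & #|SL3 F| %/ #|parabolic F| = (q ^ 3 - 1) %/ (q - 1)]%N)
  /\
  (gcdn (q - 1) 3 = 3 ->
     (exists Z3 G3 : {group {'GL_3[F]}},
        [/\ Z3 \subset 'Z(SL3 F), #|Z3| = 3 & is_G3 Z3 G3])
     /\
     (forall Z3 G3 : {group {'GL_3[F]}},
        Z3 \subset 'Z(SL3 F) -> #|Z3| = 3 -> is_G3 Z3 G3 ->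
        [/\ gives_min_faithful_perm_rep (SL3_group F) G3,
            min_perm_degree (SL3_group F) = #|SL3 F| %/ #|G3|
          & #|SL3 F| %/ #|G3| = ((q ^ 3 - 1) * (q - 1)`_3) %/ (q - 1)]%N)).
Proof.
subst q; split=> [g1 | g3]; first exact: (PB_minimal_rep odd_q g1).
split; first exact: (exists_maximal_candidate odd_q g3).
move=> Z3 G3 sZ cZ [cand maxG].
exact: (G3_minimal_rep odd_q g3 sZ cZ cand maxG).
Qed.
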